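(* There is a canonical functor $\mathfrak{M}:\mathbf{S}^{\mathrm{op}}\times\mathbf{S}_{\mathrm{fd}}\to\mathbf{indS}_{\mathrm{fd}}$, namely the functor induced on the opposite categories by $\mathfrak{A}:\mathbf{A}_{\mathrm{fg}}\times\mathbf{A}^{\mathrm{op}}\to\mathbf{proA}_{\mathrm{fg}}$ (so $\mathfrak{M}(\mathfrak{S}C,\mathfrak{S}B)=\mathfrak{S}\mathfrak{A}(B,C)$), such that for all $S_1\in\mathbf{S}$ and $S_2\in\mathbf{S}_{\mathrm{fd}}$ there is a natural bijection between the set of mappings from $S_1$ to $S_2$ and the set of points of $\mathfrak{M}(S_1,S_2)$.
   Context: Fix a field $\mathbb{K}$; algebras and tensor products are over $\mathbb{K}$. $\mathbf{A}$ is the category of unital associative (not necessarily commutative) algebras with unit-preserving morphisms, and $\mathbf{A}_{\mathrm{fg}}$ its full subcategory of finitely generated algebras. For a category $\mathbf{C}$, $\mathbf{proC}$ is the category of pro-objects (inverse systems $\{C_i\}_{i\in\mathbf{I}}$ in $\mathbf{C}$ indexed by directed sets) with $\mathbf{proC}(C,D)=\varprojlim_j\varinjlim_i\mathbf{C}(C_i,D_j)$; objects of $\mathbf{C}$ are regarded as pro-objects over a one-element index set. For pro-algebras $A=\{A_i\}_{i\in\mathbf I}$, $B=\{B_j\}_{j\in\mathbf J}$, $A\otimes B$ is the pro-algebra indexed by $\mathbf{I}\times\mathbf{J}$ with $(A\otimes B)_{(i,j)}=A_i\otimes B_j$ and the evident transition maps. Schemes: $\mathbf{S}:=\mathbf{A}^{\mathrm{op}}$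 is the category of schemes, and its morphisms are called mappings; $\mathbf{S}_{\mathrm{fd}}:=\mathbf{A}_{\mathrm{fg}}^{\mathrm{op}}$ (finite dimensional schemes); $\mathbf{indS}=\mathbf{proA}^{\mathrm{op}}$ and $\mathbf{indS}_{\mathrm{fd}}=\mathbf{proA}_{\mathrm{fg}}^{\mathrm{op}}$. The symbol $\mathfrak{S}$ denotes the renaming duality functor from a category of (pro-)algebras to the corresponding opposite category of (ind-)schemes. A point of the ind-scheme $\mathfrak{S}A$, with $A$ a pro-algebra, is a pro-morphism from $A$ to $\mathbb{K}$. The functor $\mathfrak{A}:\mathbf{A}_{\mathrm{fg}}\times\mathbf{A}^{\mathrm{op}}\to\mathbf{proA}_{\mathrm{fg}}$ is the one that comes with pro-morphisms $\mathfrak{h}(B,C):B\to C\otimes\mathfrak{A}(B,C)$, natural in the sense that $(\mathrm{id}\otimes\mathfrak{A}(g,f))\mathfrak{h}(B,C)=(f\otimes\mathrm{id})\mathfrak{h}(B',C')g$ for $g:B\to B'$, $f:C'\to C$, and characterized by the universal property: for every $E\in\mathbf{proA}$ and pro-morphism $e:B\to C\otimes E$ there is a unique pro-morphism $\hat e:\mathfrak{A}(B,C)\to E$ with $e=(\mathrm{id}_C\otimes\hat e)\mathfrak{h}(B,C)$. *)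

(* Defs.v *)
(* MathComp, with the classical axioms of mathcomp.classical.boolp. *)
From HB Require Import structures.
From mathcomp Require Import all_boot all_order all_algebra.
From mathcomp Require Import generic_quotient.
From mathcomp Require Import boolp classical_sets.

Set Implicit Arguments.
Unset Strict Implicit.
Unset Printing Implicit Defensive.

Import GRing.Theory.
Local Open Scope ring_scope.
Local Open Scope quotient_scope.

(** * Categories *)

Record category := Category {
  ob :> Type;
  mor : ob -> ob -> Type;
  idm : forall a, mor a a;
  mcomp : forall a b c, mor b c -> mor a b -> mor a c;
  comp1m : forall a b (f : mor a b), mcomp (idm b) f = f;
  compm1 : forall a b (f : mor a b), mcomp f (idm a) = f;
  compA : forall a b c d (h : mor c d) (g : mor b c) (f : mor a b),
    mcomp h (mcomp g f) = mcomp (mcomp h g) f }.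

Arguments mor : clear implicits.
Arguments idm {c} a : rename.
Arguments mcomp {c0 a b c} g f : rename.

Declare Scope cat_scope.
Delimit Scope cat_scope with cat.
Local Open Scope cat_scope.
Notation "g \oc f" := (mcomp g f) (at level 50, left associativity) : cat_scope.

Record functor (C D : category) := Functor {
  fob :> C -> D;
  fmap : forall a b, mor C a b -> mor D (fob a) (fob b);
  fmap_id : forall a, fmap (idm a) = idm (fob a);
  fmap_comp : forall a b c (g : mor C b c) (f : mor C a b),
    fmap (g \oc f) = fmap g \oc fmap f }.

Arguments fmap {C D} F {a b} f : rename.

Definition opcat (C : category) : category :=
  @Category C (fun a b => mor C b a) (fun a => idm a)
    (fun a b c g f => f \oc g)
    (fun a b f => compm1 f) (fun a b f => comp1m f)
    (fun a b c d h g f => esym (compA f g h)).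

Program Definition prodcat (C D : category) : category :=
  @Category (C * D)%type (fun x y => (mor C x.1 y.1 * mor D x.2 y.2)%type)
    (fun x => (idm x.1, idm x.2))
    (fun x y z g f => (g.1 \oc f.1, g.2 \oc f.2)) _ _ _.
Next Obligation. by rewrite !comp1m. Qed.
Next Obligation. by rewrite !compm1. Qed.
Next Obligation. by rewrite !compA. Qed.

Definition fullsub (C : category) (P : C -> Prop) : category :=
  @Category {x : C | P x} (fun x y => mor C (sval x) (sval y))
    (fun x => idm (sval x)) (fun x y z g f => g \oc f)
    (fun x y f => comp1m f) (fun x y f => compm1 f)
    (fun x y z t h g f => compA h g f).

Definition incl (C : category) (P : C -> Prop) : functor (fullsub P) C :=
  @Functor (fullsub P) C (fun x => sval x) (fun x y f => f)
    (fun x => erefl) (fun x y z g f => erefl).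

Program Definition compF (C D E : category) (G : functor D E) (F : functor C D)
    : functor C E :=
  @Functor C E (fun x => G (F x)) (fun x y f => fmap G (fmap F f)) _ _.
Next Obligation. by rewrite !fmap_id. Qed.
Next Obligation. by rewrite !fmap_comp. Qed.

Definition opF (C D : category) (F : functor C D) :
    functor (opcat C) (opcat D) :=
  @Functor (opcat C) (opcat D) F (fun x y f => fmap F f)
    (fun x => fmap_id F x) (fun x y z g f => fmap_comp F f g).

(* The functor that F : X * Y^op -> Z induces on the opposite categories, the
   two arguments being written in the other order. *)
Definition dualF (X Y Z : category) (F : functor (prodcat X (opcat Y)) Z) :
    functor (prodcat (opcat (opcat Y)) (opcat X)) (opcat Z) :=
  @Functor (prodcat (opcat (opcat Y)) (opcat X)) (opcat Z)
    (fun p => F (p.2, p.1))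
    (fun p q f => @fmap _ _ F (q.2, q.1) (p.2, p.1) (f.2, f.1))
    (fun p => fmap_id F (p.2, p.1))
    (fun p q r g f =>
       @fmap_comp _ _ F (r.2, r.1) (q.2, q.1) (p.2, p.1) (f.2, f.1) (g.2, g.1)).

(** * Pro-objects *)

(* A directed set is a nonempty preordered set in which any two elements have
   an upper bound; antisymmetry is not required. *)
Record dirset := Dirset {
  dcar :> Type;
  dle : dcar -> dcar -> Prop;
  dle_refl : forall i, dle i i;
  dle_trans : forall i j k, dle i j -> dle j k -> dle i k;
  dpt : inhabited dcar;
  ddir : forall i j, exists2 k, dle i k & dle j k }.

Program Definition unitdir : dirset :=
  @Dirset unit (fun _ _ => True) _ _ (inhabits tt) _.
Next Obligation. by exists tt. Qed.

Program Definition proddir (I J : dirset) : dirset :=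
  @Dirset (I * J)%type (fun x y => dle x.1 y.1 /\ dle x.2 y.2) _ _ _ _.
Next Obligation. by split; apply: dle_refl. Qed.
Next Obligation. by split=> /=; [apply: dle_trans H H0|apply: dle_trans H2 H1]. Qed.
Next Obligation. by case: (dpt I) (dpt J) => i [j]; exists; exact: (i, j). Qed.
Next Obligation.
have [k1 ? ?] := ddir d1 d; have [k2 ? ?] := ddir d2 d0.
by exists (k1, k2).
Qed.

(* A transition map may use any proof that i <= j; by proof irrelevance it
   does not depend on it. *)
Record proobj (C : category) := ProObj {
  pidx : dirset;
  pob :> pidx -> C;
  ptr : forall i j, dle i j -> mor C (pob j) (pob i);
  ptr_id : forall i (h : dle i i), ptr h = idm (pob i);
  ptr_comp : forall i j k (h : dle i j) (h' : dle j k) (h'' : dle i k),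
    ptr h \oc ptr h' = ptr h'' }.

Arguments ptr {C} X {i j} h : rename.

Section Colim.
Variable C : category.
Implicit Types (X : proobj C) (c d : C).

Definition pregerm X d := {i : pidx X & mor C (X i) d}.

Definition germ_eq X d (x y : pregerm X d) : Prop :=
  exists k (h : dle (tag x) k) (h' : dle (tag y) k),
    tagged x \oc ptr X h = tagged y \oc ptr X h'.

(* The filtered colimit of the sets C(X_i, d), its elements being the
   equivalence classes. *)
Record colim X d := Colim {
  cls : set (pregerm X d);
  clsP : exists x, cls = [set y | germ_eq x y]%classic }.

Definition germ X d i (f : mor C (X i) d) : colim X d :=
  @Colim X d _ (ex_intro _ (existT _ i f) erefl).

Definition cidx X d (a : colim X d) : pidx X := tag (projT1 (cid (clsP a))).
Definition crep X d (a : colim X d) : mor C (X (cidx a)) d :=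
  tagged (projT1 (cid (clsP a))).

Lemma germ_eq_refl X d (x : pregerm X d) : germ_eq x x.
Proof. by exists (tag x), (dle_refl _), (dle_refl _). Qed.

Lemma germ_eq_sym X d (x y : pregerm X d) : germ_eq x y -> germ_eq y x.
Proof. by move=> [k [h [h' e]]]; exists k, h', h. Qed.

Lemma germ_eq_trans X d (x y z : pregerm X d) :
  germ_eq x y -> germ_eq y z -> germ_eq x z.
Proof.
move=> [k [h1 [h2 e]]] [l [h3 [h4 e']]]; have [m km lm] := ddir k l.
exists m, (dle_trans h1 km), (dle_trans h4 lm).
rewrite -(ptr_comp h1 km) -(ptr_comp h4 lm) !compA e -e' -!compA.
by rewrite (ptr_comp h2 km (dle_trans h2 km)) (ptr_comp h3 lm (dle_trans h2 km)).
Qed.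

Lemma colim_inj X d (a b : colim X d) : cls a = cls b -> a = b.
Proof.
by case: a b => [s p] [s' p'] /= e; subst s'; rewrite (Prop_irrelevance p p').
Qed.

Lemma germP X d i j (f : mor C (X i) d) (g : mor C (X j) d) :
  germ f = germ g <-> exists k (h : dle i k) (h' : dle j k),
    f \oc ptr X h = g \oc ptr X h'.
Proof.
split=> [/(congr1 (@cls _ _))/= e|e].
- have : [set y | germ_eq (existT _ i f) y]%classic (existT _ j g).
    by rewrite e; exact: germ_eq_refl.
  by case=> k [h [h' E]]; exists k, h, h'.
- have E : germ_eq (existT (fun i => mor C (X i) d) i f) (existT _ j g).
    by case: e => k [h [h' E]]; exists k, h, h'.
  apply: colim_inj => /=; rewrite predeqE => y; split=> H.
  + exact: germ_eq_trans (germ_eq_sym E) H.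
  + exact: germ_eq_trans E H.
Qed.

Lemma crepK X d (a : colim X d) : germ (crep a) = a.
Proof.
apply: colim_inj; rewrite /crep /cidx /=; case: (cid (clsP a)) => [[i f] /= e].
by rewrite e.
Qed.

Lemma colimP X d (a : colim X d) : exists i (f : mor C (X i) d), a = germ f.
Proof. by exists (cidx a), (crep a); rewrite crepK. Qed.

Lemma germ_tr X d i j (h : dle i j) (f : mor C (X i) d) :
  germ (f \oc ptr X h) = germ f.
Proof.
apply/germP; exists j, (dle_refl j), h.
by rewrite ptr_id compm1.
Qed.

(* C(X_i, d) -> C(X_i, d') on the colimits over i. *)
Definition cpost X d d' (f : mor C d d') (a : colim X d) : colim X d' :=
  germ (f \oc crep a).

Lemma cpost_germ X d d' (f : mor C d d') i (g : mor C (X i) d) :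
  cpost f (germ g) = germ (f \oc g).
Proof.
apply/germP; have /germP [k [h [h' e]]] := crepK (germ g).
by exists k, h, h'; rewrite -!compA e.
Qed.

Lemma cpost_id X d (a : colim X d) : cpost (idm d) a = a.
Proof. by case: (colimP a) => i [f ->]; rewrite cpost_germ comp1m. Qed.

Lemma cpost_comp X d d' d'' (g : mor C d' d'') (f : mor C d d')
  (a : colim X d) : cpost (g \oc f) a = cpost g (cpost f a).
Proof. by case: (colimP a) => i [h ->]; rewrite !cpost_germ compA. Qed.

End Colim.

Arguments germ {C X d i} f.

Section ProCat.
Variable C : category.
Implicit Types X Y Z : proobj C.

(* proC(X, Y) = lim_j colim_i C(X_i, Y_j). *)
Record prohom X Y := ProHom {
  phf :> forall j : pidx Y, colim X (Y j);
  phf_compat : forall j j' (h : dle j j'), cpost (ptr Y h) (phf j') = phf j }.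

Lemma prohom_ext X Y (f g : prohom X Y) : (forall j, f j = g j) -> f = g.
Proof.
case: f g => [f p] [g q] /= e.
have {}e : f = g by exact: functional_extensionality_dep.
subst g.
by rewrite (Prop_irrelevance p q).
Qed.

Program Definition proid X : prohom X X :=
  @ProHom X X (fun j => germ (idm (X j))) _.
Next Obligation.
by rewrite cpost_germ compm1 -[RHS](germ_tr h) comp1m.
Qed.

(* If g_k is the class of g' : Y_j -> Z_k, then (g f)_k = g' f_j. *)
Definition procomp_fun X Y Z (g : prohom Y Z) (f : prohom X Y) k :=
  cpost (crep (g k)) (f (cidx (g k))).

Lemma cpost_indep X Y d (f : prohom X Y) j j' (a : mor C (Y j) d)
    (b : mor C (Y j') d) :
  germ a = germ b -> cpost a (f j) = cpost b (f j').
Proof.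
move=> /germP [k [h [h' e]]].
by rewrite -(phf_compat f h) -(phf_compat f h') -!cpost_comp e.
Qed.

Lemma procomp_funE X Y Z (g : prohom Y Z) (f : prohom X Y) k j
    (g' : mor C (Y j) (Z k)) :
  g k = germ g' -> procomp_fun g f k = cpost g' (f j).
Proof. by move=> e; apply: cpost_indep; rewrite crepK. Qed.

Program Definition procomp X Y Z (g : prohom Y Z) (f : prohom X Y) :
  prohom X Z := @ProHom X Z (procomp_fun g f) _.
Next Obligation.
rewrite {1}/procomp_fun -cpost_comp; apply: cpost_indep.
by rewrite -cpost_germ !crepK phf_compat.
Qed.

Program Definition procat : category :=
  @Category (proobj C) prohom proid procomp _ _ _.
Next Obligation.
by apply: prohom_ext => j /=; rewrite (@procomp_funE _ _ _ _ _ _ j (idm _)) ?cpost_id.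
Qed.
Next Obligation.
apply: prohom_ext => j /=; rewrite /procomp_fun.
by rewrite cpost_germ compm1 crepK.
Qed.
Next Obligation.
apply: prohom_ext => l /=; rewrite /procomp_fun /= /procomp_fun.
rewrite -cpost_comp; apply: cpost_indep.
by rewrite -cpost_germ !crepK.
Qed.

(* An object of C as a pro-object over a one-element index set. *)
Program Definition constob (c : C) : proobj C :=
  @ProObj C unitdir (fun _ => c) (fun _ _ _ => idm c) _ _.
Next Obligation. by rewrite comp1m. Qed.

Program Definition constpro : functor C procat :=
  @Functor C procat constob
    (fun c d f => @ProHom (constob c) (constob d)
       (fun _ => @germ C (constob c) d tt f) _) _ _.
Next Obligation. by rewrite cpost_germ comp1m. Qed.
Next Obligation. by apply: prohom_ext => -[]. Qed.
Next Obligation.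
apply: prohom_ext => -[] /=.
by rewrite (@procomp_funE _ (constob b) (constob c) _ _ _ tt g) ?cpost_germ.
Qed.

End ProCat.

(* A functor applied levelwise to pro-objects. *)
Section ProFunctor.
Variables (C D : category) (F : functor C D).

Program Definition proFob (X : proobj C) : proobj D :=
  @ProObj D (pidx X) (fun i => F (X i)) (fun i j h => fmap F (ptr X h)) _ _.
Next Obligation. by rewrite ptr_id fmap_id. Qed.
Next Obligation. by rewrite -fmap_comp (ptr_comp h h' h''). Qed.

Definition cmap (X : proobj C) d (a : colim X d) : colim (proFob X) (F d) :=
  @germ D (proFob X) (F d) (cidx a) (fmap F (crep a)).

Lemma cmap_germ (X : proobj C) d i (f : mor C (X i) d) :
  cmap (germ f) = @germ D (proFob X) (F d) i (fmap F f).
Proof.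
apply/germP; have /germP [k [h [h' e]]] := crepK (germ f).
by exists k, h, h'; rewrite /= -!fmap_comp e.
Qed.

Lemma cmap_post (X : proobj C) d d' (f : mor C d d') (a : colim X d) :
  cmap (cpost f a) = cpost (fmap F f) (cmap a).
Proof.
by case: (colimP a) => i [g ->]; rewrite !(cpost_germ, cmap_germ) fmap_comp.
Qed.

Program Definition proFmap (X Y : proobj C) (f : prohom X Y) :
    prohom (proFob X) (proFob Y) :=
  @ProHom D (proFob X) (proFob Y) (fun j => cmap (f j)) _.
Next Obligation. by rewrite -cmap_post phf_compat. Qed.

Program Definition proF : functor (procat C) (procat D) :=
  @Functor (procat C) (procat D) proFob proFmap _ _.
Next Obligation.
by apply: prohom_ext => j /=; rewrite cmap_germ fmap_id.
Qed.
Next Obligation.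
apply: prohom_ext => k /=; rewrite /procomp_fun cmap_post.
by apply: (cpost_indep (proFmap f)); rewrite -cmap_germ !crepK.
Qed.

End ProFunctor.

(* A pair of pro-objects as a pro-object of the product category, indexed by
   the product of the index sets. *)
Section ProPair.
Variables C D : category.

Program Definition propair_ob (X : proobj C) (Y : proobj D) :
    proobj (prodcat C D) :=
  @ProObj (prodcat C D) (proddir (pidx X) (pidx Y)) (fun p => (X p.1, Y p.2))
    (fun p q h => (ptr X (proj1 h), ptr Y (proj2 h))) _ _.
Next Obligation. by rewrite !ptr_id. Qed.
Next Obligation. by congr pair; apply: ptr_comp. Qed.

Definition cpair (X : proobj C) (Y : proobj D) c d
    (a : colim X c) (b : colim Y d) : colim (propair_ob X Y) (c, d) :=
  @germ (prodcat C D) (propair_ob X Y) (c, d) (cidx a, cidx b) (crep a, crep b).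

Lemma cpair_germ (X : proobj C) (Y : proobj D) c d i j (f : mor C (X i) c)
    (g : mor D (Y j) d) :
  cpair (germ f) (germ g) =
  @germ (prodcat C D) (propair_ob X Y) (c, d) (i, j) (f, g).
Proof.
apply/germP; have /germP [k [h [h' e]]] := crepK (germ f).
have /germP [l [m [m' e']]] := crepK (germ g).
exists (k, l), (conj h m), (conj h' m') => /=.
have irr (P : Prop) (p q : P) : p = q by exact: Prop_irrelevance.
rewrite (irr _ (proj1 (conj h m)) h) (irr _ (proj1 (conj h' m')) h').
by rewrite (irr _ (proj2 (conj h m)) m) (irr _ (proj2 (conj h' m')) m') e e'.
Qed.

Lemma cpair_post (X : proobj C) (Y : proobj D) c c' d d' (f : mor C c c')
    (g : mor D d d') (a : colim X c) (b : colim Y d) :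
  cpair (cpost f a) (cpost g b) =
  @cpost (prodcat C D) _ (c, d) (c', d') (f, g) (cpair a b).
Proof.
case: (colimP a) (colimP b) => i [u ->] [j [v ->]].
by rewrite !(cpost_germ, cpair_germ).
Qed.

Program Definition propair_map (X X' : proobj C) (Y Y' : proobj D)
    (f : prohom X X') (g : prohom Y Y') :
    prohom (propair_ob X Y) (propair_ob X' Y') :=
  @ProHom (prodcat C D) (propair_ob X Y) (propair_ob X' Y')
    (fun j => cpair (f j.1) (g j.2)) _.
Next Obligation. by rewrite -cpair_post !phf_compat. Qed.

Lemma propair_map_comp (X X' X'' : proobj C) (Y Y' Y'' : proobj D)
    (f' : prohom X' X'') (g' : prohom Y' Y'') (f : prohom X X')
    (g : prohom Y Y') :
  propair_map (procomp f' f) (procomp g' g) =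
  procomp (propair_map f' g') (propair_map f g).
Proof.
apply: prohom_ext => -[k l] /=; rewrite /procomp_fun cpair_post.
apply: (cpost_indep (propair_map f g) (j := (_, _))).
by rewrite -cpair_germ !crepK.
Qed.

Program Definition propair :
    functor (prodcat (procat C) (procat D)) (procat (prodcat C D)) :=
  @Functor (prodcat (procat C) (procat D)) (procat (prodcat C D))
    (fun p => propair_ob p.1 p.2) (fun p q f => propair_map f.1 f.2) _ _.
Next Obligation. by apply: prohom_ext => -[i j] /=; rewrite cpair_germ. Qed.
Next Obligation. exact: propair_map_comp. Qed.

End ProPair.

(** * Unital associative algebras *)

(* A vector space with a bilinear, associative and unital product. MathComp's
   algType requires 1 != 0, which would exclude the zero algebra. *)
HB.mixin Record Lmodule_isUAlgebra (K : pzRingType) A of GRing.Lmodule K A := {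
  aone : A;
  amul : A -> A -> A;
  amulA : associative amul;
  amul1x : left_id aone amul;
  amulx1 : right_id aone amul;
  amul_linl : forall y : A, linear (amul^~ y);
  amul_linr : forall x : A, linear (amul x) }.

#[short(type="ualgType")]
HB.structure Definition UAlgebra (K : pzRingType) :=
  {A of GRing.Lmodule K A & Lmodule_isUAlgebra K A}.

Notation "x ** y" := (amul x y) (at level 40, left associativity) : ring_scope.

Section Regular.
Variable K : comPzRingType.
Local Notation Ko := (GRing.regular K).

Let regular_linl (y : Ko) : linear (fun x : Ko => x * y).
Proof. by move=> a x x'; rewrite mulrDl -mulrA. Qed.
Let regular_linr (x : Ko) : linear (fun y : Ko => x * y).
Proof. by move=> a y y'; rewrite mulrDr; congr +%R; apply: mulrCA. Qed.

#[export]
HB.instance Definition _ := Lmodule_isUAlgebra.Build K Ko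
  (@mulrA K) (@mul1r K) (@mulr1 K) regular_linl regular_linr.

End Regular.

Section UAlgTheory.
Variables (K : pzRingType) (A : ualgType K).
Implicit Types x y z : A.

Lemma amulDl x y z : (x + y) ** z = x ** z + y ** z.
Proof. by have := amul_linl z 1 x y; rewrite !scale1r. Qed.
Lemma amulDr x y z : x ** (y + z) = x ** y + x ** z.
Proof. by have := amul_linr x 1 y z; rewrite !scale1r. Qed.
Lemma amul0x x : 0 ** x = 0.
Proof. by apply: (addIr (0 ** x)); rewrite -amulDl !add0r. Qed.
Lemma amulx0 x : x ** 0 = 0.
Proof. by apply: (addIr (x ** 0)); rewrite -amulDr !add0r. Qed.
Lemma ascaleAl (a : K) x y : a *: (x ** y) = (a *: x) ** y.
Proof. by have := amul_linl y a x 0; rewrite amul0x !addr0. Qed.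
Lemma ascaleAr (a : K) x y : a *: (x ** y) = x ** (a *: y).
Proof. by have := amul_linr x a y 0; rewrite amulx0 !addr0. Qed.
Lemma amul_suml I (r : seq I) (F : I -> A) x :
  (\sum_(i <- r) F i) ** x = \sum_(i <- r) F i ** x.
Proof. exact: (big_morph _ (fun y z => amulDl y z x) (amul0x x)). Qed.
Lemma amul_sumr I (r : seq I) (F : I -> A) x :
  x ** (\sum_(i <- r) F i) = \sum_(i <- r) x ** F i.
Proof. exact: (big_morph _ (amulDr x) (amulx0 x)). Qed.

End UAlgTheory.

Section AlgMorphism.
Variable K : fieldType.
Implicit Types A B C : ualgType K.

(* K-linear multiplicative maps preserving 1. *)
Record alg_hom A B := AlgHom {
  alg_fun :> A -> B;
  alg_lin : linear alg_fun;
  alg_one : alg_fun aone = aone;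
  alg_mul : {morph alg_fun : x y / x ** y} }.

Lemma alg_hom_ext A B (f g : alg_hom A B) : f =1 g -> f = g.
Proof.
case: f g => [f p q r] [g p' q' r'] /= e.
have {}e : f = g by apply/funext.
subst g; rewrite (Prop_irrelevance p p') (Prop_irrelevance q q').
by rewrite (Prop_irrelevance r r').
Qed.

Definition alg_id A : alg_hom A A :=
  @AlgHom A A (fun x => x) (fun _ _ _ => erefl) erefl (fun _ _ => erefl).

Program Definition alg_comp A B C (g : alg_hom B C) (f : alg_hom A B) :
  alg_hom A C := @AlgHom A C (fun x => g (f x)) _ _ _.
Next Obligation. by move=> a x y; rewrite !alg_lin. Qed.
Next Obligation. by rewrite !alg_one. Qed.
Next Obligation. by move=> x y; rewrite !alg_mul. Qed.

Program Definition algCat : category :=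
  @Category (ualgType K) alg_hom alg_id alg_comp _ _ _.
Next Obligation. exact: alg_hom_ext. Qed.
Next Obligation. exact: alg_hom_ext. Qed.
Next Obligation. exact: alg_hom_ext. Qed.

(* Some finite set lies in no proper unital subalgebra. *)
Definition fin_gen (A : algCat) : Prop :=
  exists s : seq (A : ualgType K), forall S : {pred (A : ualgType K)},
    [/\ aone \in S, linear_closed S & {in S &, forall x y, x ** y \in S}] ->
    {subset s <= S} -> forall x, x \in S.

Definition algfgCat : category := fullsub fin_gen.

End AlgMorphism.
Arguments algCat : clear implicits.
Arguments algfgCat : clear implicits.

(** * Tensor products *)

Section Tensor.
Variable K : fieldType.
Implicit Types W : lmodType K.

Section Module.
Variables U V : lmodType K.

Definition is_bilinear (W : lmodType K) (f : U -> V -> W) : Prop :=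
  (forall v, linear (f^~ v)) /\ (forall u, linear (f u)).

(* The value at a formal sum of pairs (u, v) of the linear map that a bilinear
   map induces. *)
Definition tval (W : lmodType K) (f : U -> V -> W) (s : seq (U * V)) : W :=
  \sum_(p <- s) f p.1 p.2.

(* Two formal sums are equal as tensors when no bilinear map separates them. *)
Definition tens_eq : rel (seq (U * V)) := fun s t =>
  `[< forall (W : lmodType K) (f : U -> V -> W), is_bilinear f ->
        tval f s = tval f t >].

Lemma tens_eqP s t : reflect (forall (W : lmodType K) (f : U -> V -> W),
  is_bilinear f -> tval f s = tval f t) (tens_eq s t).
Proof. exact: asboolP. Qed.

Lemma tens_eq_refl : reflexive tens_eq.
Proof. by move=> s; apply/tens_eqP. Qed.

Lemma tens_eq_sym : symmetric tens_eq.
Proof.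
by move=> s t; apply/tens_eqP/tens_eqP => h W f bf; rewrite h.
Qed.

Lemma tens_eq_trans : transitive tens_eq.
Proof.
move=> t s u /tens_eqP h /tens_eqP h'; apply/tens_eqP => W f bf.
by rewrite h // h'.
Qed.

Canonical tens_equiv := EquivRel tens_eq tens_eq_refl tens_eq_sym tens_eq_trans.

Definition tensor := {eq_quot tens_equiv}.
HB.instance Definition _ := Choice.on tensor.

Definition tcl (s : seq (U * V)) : tensor := \pi_{eq_quot tens_equiv} s.
Definition trep (x : tensor) : seq (U * V) := repr x.

Lemma tclE s t : tcl s = tcl t <-> forall (W : lmodType K) (f : U -> V -> W),
  is_bilinear f -> tval f s = tval f t.
Proof.
split=> [/eqmodP/tens_eqP //|h]; apply/eqmodP; exact/tens_eqP.
Qed.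

Lemma tclK x : tcl (trep x) = x. Proof. exact: reprK. Qed.

Lemma tval_rep W (f : U -> V -> W) s : is_bilinear f ->
  tval f (trep (tcl s)) = tval f s.
Proof. by move=> bf; have /tclE -> := tclK (tcl s). Qed.

Lemma tensor_eqP (x y : tensor) : x = y <->
  forall (W : lmodType K) (f : U -> V -> W),
    is_bilinear f -> tval f (trep x) = tval f (trep y).
Proof. by rewrite -tclE !tclK. Qed.

Lemma tval_cat W (f : U -> V -> W) s t : tval f (s ++ t) = tval f s + tval f t.
Proof. by rewrite /tval big_cat. Qed.

Lemma tval_nil W (f : U -> V -> W) : tval f [::] = 0.
Proof. by rewrite /tval big_nil. Qed.

Definition tscale_seq (a : K) (s : seq (U * V)) := [seq (a *: p.1, p.2) | p <- s].

Lemma tval_scale W (f : U -> V -> W) a s : is_bilinear f ->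
  tval f (tscale_seq a s) = a *: tval f s.
Proof.
move=> [fl _]; rewrite /tval big_map scaler_sumr; apply: eq_bigr => p _ /=.
by rewrite (scalable_linear (fl p.2)).
Qed.

Definition tzero := tcl [::].
Definition tadd x y := tcl (trep x ++ trep y).
Definition tscale a x := tcl (tscale_seq a (trep x)).
Definition topp x := tscale (-1) x.

Lemma tval_add W (f : U -> V -> W) x y : is_bilinear f ->
  tval f (trep (tadd x y)) = tval f (trep x) + tval f (trep y).
Proof. by move=> bf; rewrite tval_rep // tval_cat. Qed.

Lemma tval_tscale W (f : U -> V -> W) a x : is_bilinear f ->
  tval f (trep (tscale a x)) = a *: tval f (trep x).
Proof. by move=> bf; rewrite tval_rep // tval_scale. Qed.

Lemma tval_zero W (f : U -> V -> W) : is_bilinear f ->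
  tval f (trep tzero) = 0.
Proof. by move=> bf; rewrite tval_rep // tval_nil. Qed.

Let taddA : associative tadd.
Proof.
by move=> x y z; apply/tensor_eqP => W f bf; rewrite !tval_add // addrA.
Qed.
Let taddC : commutative tadd.
Proof.
by move=> x y; apply/tensor_eqP => W f bf; rewrite !tval_add // addrC.
Qed.
Let tadd0 : left_id tzero tadd.
Proof.
by move=> x; apply/tensor_eqP => W f bf; rewrite tval_add // tval_zero // add0r.
Qed.
Let taddN : left_inverse tzero topp tadd.
Proof.
move=> x; apply/tensor_eqP => W f bf.
by rewrite tval_add // tval_tscale // tval_zero // scaleN1r addNr.
Qed.
HB.instance Definition _ := GRing.isZmodule.Build tensor taddA taddC tadd0 taddN.

Let tscaleA a b x : tscale a (tscale b x) = tscale (a * b) x.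
Proof. by apply/tensor_eqP => W f bf; rewrite !tval_tscale // scalerA. Qed.
Let tscale1 : left_id 1 tscale.
Proof. by move=> x; apply/tensor_eqP => W f bf; rewrite tval_tscale // scale1r. Qed.
Let tscaleDr : right_distributive tscale +%R.
Proof.
move=> a x y; apply/tensor_eqP => W f bf.
by rewrite !(tval_tscale, tval_add) // scalerDr.
Qed.
Let tscaleDl x : {morph tscale^~ x : a b / a + b}.
Proof.
move=> a b; apply/tensor_eqP => W f bf.
by rewrite !(tval_tscale, tval_add) // scalerDl.
Qed.
HB.instance Definition _ :=
  GRing.Zmodule_isLmodule.Build K tensor tscaleA tscale1 tscaleDr tscaleDl.

Definition tpure (u : U) (v : V) : tensor := tcl [:: (u, v)].

Lemma tval_pure W (f : U -> V -> W) u v : is_bilinear f ->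
  tval f (trep (tpure u v)) = f u v.
Proof. by move=> bf; rewrite tval_rep // /tval big_seq1. Qed.

Definition tlift (W : lmodType K) (f : U -> V -> W) (x : tensor) : W :=
  tval f (trep x).

Lemma tpure_bilinear : is_bilinear tpure.
Proof.
split=> [v a u u'|u a v v']; apply/tensor_eqP => W f bf;
  rewrite tval_add // tval_tscale // !tval_pure //; first by rewrite bf.1.
by rewrite bf.2.
Qed.

Lemma tlift_linear W (f : U -> V -> W) : is_bilinear f -> linear (tlift f).
Proof.
by move=> bf a x y; rewrite /tlift tval_add // tval_tscale.
Qed.

Lemma tlift_pure W (f : U -> V -> W) u v : is_bilinear f ->
  tlift f (tpure u v) = f u v.
Proof. exact: tval_pure. Qed.

Lemma tensor_sum (x : tensor) : x = \sum_(p <- trep x) tpure p.1 p.2.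
Proof.
have bp := tpure_bilinear.
apply/tensor_eqP => W f bf; elim: (trep x) => [|p s IH].
  by rewrite big_nil tval_zero // tval_nil.
rewrite big_cons tval_add // -IH tval_pure //.
by rewrite /tval big_cons.
Qed.

(* Universal property: tlift f is the only linear map extending f. *)
Lemma tensor_ext (W : lmodType K) (g h : tensor -> W) :
  linear g -> linear h -> (forall u v, g (tpure u v) = h (tpure u v)) -> g =1 h.
Proof.
move=> lg lh gh x; rewrite (tensor_sum x).
have l0 (k : tensor -> W) : linear k -> k 0 = 0.
  by move=> lk; have := lk (-1) 0 0; rewrite scaler0 add0r scaleN1r addNr.
have lD (k : tensor -> W) : linear k -> {morph k : a b / a + b}.
  by move=> lk a b; have := lk 1 a b; rewrite !scale1r.
elim: (trep x) => [|p s IH]; first by rewrite !big_nil !l0.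
by rewrite !big_cons !lD // IH gh.
Qed.

End Module.

Section Algebra.
Variables A B : ualgType K.

Definition tmul_seq (s t : seq (A * B)) :=
  [seq (p.1 ** q.1, p.2 ** q.2) | p <- s, q <- t].
Definition tmul (x y : tensor A B) : tensor A B :=
  tcl (tmul_seq (trep x) (trep y)).
Definition tone : tensor A B := tpure aone aone.

Lemma tval_mul_seq W (f : A -> B -> W) s t : tval f (tmul_seq s t) =
  tval (fun a b => tval (fun a' b' => f (a ** a') (b ** b')) t) s.
Proof. by rewrite /tval big_allpairs_dep. Qed.

Lemma bil_mulr W (f : A -> B -> W) a b : is_bilinear f ->
  is_bilinear (fun a' b' => f (a ** a') (b ** b')).
Proof.
move=> [fl fr]; split=> [v c u u'|u c v v'].
  by rewrite amul_linr fl.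
by rewrite amul_linr fr.
Qed.

Lemma bil_mull W (f : A -> B -> W) a b : is_bilinear f ->
  is_bilinear (fun a' b' => f (a' ** a) (b' ** b)).
Proof.
move=> [fl fr]; split=> [v c u u'|u c v v'].
  by rewrite amul_linl fl.
by rewrite amul_linl fr.
Qed.

Lemma bil_tval W (f : A -> B -> W) t : is_bilinear f ->
  is_bilinear (fun a b => tval (fun a' b' => f (a ** a') (b ** b')) t).
Proof.
move=> bf; split=> [v c u u'|u c v v']; rewrite /tval scaler_sumr -big_split;
  apply: eq_bigr => p _ /=; have [hl hr] := bil_mull p.1 p.2 bf.
  exact: hl.
exact: hr.
Qed.

Lemma tval_mul W (f : A -> B -> W) x y : is_bilinear f ->
  tval f (trep (tmul x y)) =
  tval (fun a b => tval (fun a' b' => f (a ** a') (b ** b')) (trep y)) (trep x).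
Proof. by move=> bf; rewrite tval_rep // tval_mul_seq. Qed.

Lemma eq_tval W (f g : A -> B -> W) s : (forall a b, f a b = g a b) ->
  tval f s = tval g s.
Proof. by move=> e; apply: eq_bigr. Qed.

Lemma tvalD W (f g : A -> B -> W) s :
  tval (fun a b => f a b + g a b) s = tval f s + tval g s.
Proof. by rewrite /tval big_split. Qed.

Lemma tvalZ W (f : A -> B -> W) c s :
  tval (fun a b => c *: f a b) s = c *: tval f s.
Proof. by rewrite /tval scaler_sumr. Qed.

Let tmulA : associative tmul.
Proof.
move=> x y z; apply/tensor_eqP => W f bf.
rewrite [LHS]tval_mul // [RHS]tval_mul //.
rewrite [RHS]tval_mul; last exact: bil_tval.
apply: eq_tval => a b; rewrite tval_mul; last exact: bil_mulr.
by apply: eq_tval => a' b'; apply: eq_tval => a'' b''; rewrite !amulA.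
Qed.
Let tmul1r : left_id tone tmul.
Proof.
move=> x; apply/tensor_eqP => W f bf; rewrite tval_mul //.
rewrite tval_pure; last exact: bil_tval.
by apply: eq_tval => a b; rewrite !amul1x.
Qed.
Let tmulr1 : right_id tone tmul.
Proof.
move=> x; apply/tensor_eqP => W f bf; rewrite tval_mul //.
apply: eq_tval => a b; rewrite tval_pure; last exact: bil_mulr.
by rewrite !amulx1.
Qed.
Let tmul_linl (y : tensor A B) : linear (tmul^~ y).
Proof.
move=> c x x'; apply/tensor_eqP => W f bf.
have bt := bil_tval (trep y) bf.
by rewrite tval_add // tval_tscale // !tval_mul // tval_add // tval_tscale.
Qed.
Let tmul_linr (x : tensor A B) : linear (tmul x).
Proof.
move=> c y y'; apply/tensor_eqP => W f bf.
rewrite tval_add // tval_tscale // !tval_mul // -tvalZ -tvalD.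
apply: eq_tval => a b; have bm := bil_mulr a b bf.
by rewrite tval_add // tval_tscale.
Qed.
HB.instance Definition _ := Lmodule_isUAlgebra.Build K (tensor A B)
  tmulA tmul1r tmulr1 tmul_linl tmul_linr.

Lemma tpureM (a a' : A) (b b' : B) :
  tpure a b ** tpure a' b' = tpure (a ** a') (b ** b').
Proof.
apply/tensor_eqP => W f bf; rewrite tval_mul // !tval_pure //.
  exact: bil_mulr.
exact: bil_tval.
Qed.

End Algebra.

(* f (x) g, determined by a (x) b |-> f a (x) g b. *)
Section Map.
Variables (A B A' B' : ualgType K) (f : alg_hom A A') (g : alg_hom B B').

Lemma tmap_bilinear : is_bilinear (fun a b => tpure (f a) (g b)).
Proof.
have [pl pr] := @tpure_bilinear A' B'.
split=> [v c u u'|u c v v']; rewrite alg_lin; first exact: pl.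
exact: pr.
Qed.

Program Definition tmap : alg_hom (tensor A B) (tensor A' B') :=
  @AlgHom _ _ _ (tlift (fun a b => tpure (f a) (g b))) _ _ _.
Next Obligation. exact: tlift_linear tmap_bilinear. Qed.
Next Obligation.
by rewrite [LHS](tlift_pure _ _ tmap_bilinear) !alg_one.
Qed.
Next Obligation.
have bf := tmap_bilinear; move=> x y.
rewrite {1}/tlift tval_mul //= [in RHS]/tlift.
pose F (z : tensor A' B') := z ** tval (fun a b => tpure (f a) (g b)) (trep y).
have Fs s : F (tval (fun a b => tpure (f a) (g b)) s) =
            \sum_(p <- s) F (tpure (f p.1) (g p.2)).
  exact: amul_suml.
rewrite [RHS]Fs; apply: eq_bigr => p _; rewrite /F amul_sumr.
by apply: eq_bigr => q _; rewrite !alg_mul tpureM.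
Qed.

Lemma tmap_pure a b : tmap (tpure a b) = tpure (f a) (g b).
Proof. exact: tlift_pure tmap_bilinear. Qed.

End Map.

Lemma alg_tensor_ext (A B : ualgType K) (C : ualgType K)
    (f g : alg_hom (tensor A B) C) :
  (forall a b, f (tpure a b) = g (tpure a b)) -> f = g.
Proof.
move=> e; apply: alg_hom_ext; apply: tensor_ext => //; exact: alg_lin.
Qed.

Lemma tmap_id (A B : ualgType K) : tmap (alg_id A) (alg_id B) = alg_id _.
Proof. by apply: alg_tensor_ext => a b; rewrite tmap_pure. Qed.

Lemma tmap_comp (A B A' B' A'' B'' : ualgType K)
    (f' : alg_hom A' A'') (g' : alg_hom B' B'')
    (f : alg_hom A A') (g : alg_hom B B') :
  tmap (alg_comp f' f) (alg_comp g' g) = alg_comp (tmap f' g') (tmap f g).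
Proof.
apply: alg_tensor_ext => a b; rewrite tmap_pure; apply: esym.
exact: etrans (congr1 (tmap f' g') (tmap_pure f g a b)) (tmap_pure f' g' _ _).
Qed.

Definition tensorF : functor (prodcat (algCat K) (algCat K)) (algCat K) :=
  @Functor (prodcat (algCat K) (algCat K)) (algCat K)
    (fun p => tensor p.1 p.2) (fun p q f => tmap f.1 f.2)
    (fun p => tmap_id p.1 p.2)
    (fun p q r g f => tmap_comp g.1 g.2 f.1 f.2).

(* (A (x) B)_(i,j) = A_i (x) B_j *)
Definition protensor : functor
    (prodcat (procat (algCat K)) (procat (algCat K))) (procat (algCat K)) :=
  compF (proF tensorF) (propair (algCat K) (algCat K)).

End Tensor.

(** * The functor frakA *)

Section FrakA.
Variable K : fieldType.

(* A finitely generated algebra, an algebra and a pro-object of finitely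
   generated algebras, all regarded as pro-algebras. *)
Definition proA_of_fg (B : algfgCat K) : procat (algCat K) :=
  constpro (algCat K) (incl (@fin_gen K) B).
Definition proA_of (C : algCat K) : procat (algCat K) := constpro (algCat K) C.
Definition proAfg_incl : functor (procat (algfgCat K)) (procat (algCat K)) :=
  proF (incl (@fin_gen K)).

Definition frakA_type :=
  functor (prodcat (algfgCat K) (opcat (algCat K))) (procat (algfgCat K)).

(* C (x) frakA(B, C) as a pro-algebra, and the type of the family frak h. *)
Definition tensA (FA : frakA_type) (B : algfgCat K) (C : algCat K) :
    procat (algCat K) :=
  protensor K (proA_of C, proAfg_incl (FA (B, C))).
Definition frakh_type (FA : frakA_type) :=
  forall (B : algfgCat K) (C : algCat K),
    mor (procat (algCat K)) (proA_of_fg B) (tensA FA B C).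

(* f (x) g for pro-morphisms f and g. *)
Definition protensor_map (X X' Y Y' : procat (algCat K)) (f : mor _ X X') (g : mor _ Y Y')
    : mor _ (protensor K (X, Y)) (protensor K (X', Y')) :=
  @fmap _ _ (protensor K) (X, Y) (X', Y') (f, g).

Definition frakh_natural (FA : frakA_type) (h : frakh_type FA) : Prop :=
  forall (B B' : algfgCat K) (C C' : algCat K)
      (g : mor (algfgCat K) B B') (f : mor (algCat K) C' C),
    protensor_map (idm (proA_of C))
         (fmap proAfg_incl (@fmap _ _ FA (B, C) (B', C') (g, f)))
      \oc h B C =
    protensor_map (fmap (constpro (algCat K)) f) (idm (proAfg_incl (FA (B', C'))))
      \oc h B' C' \oc fmap (constpro (algCat K)) (fmap (incl (@fin_gen K)) g).

Definition frakh_universal (FA : frakA_type) (h : frakh_type FA) : Prop :=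
  forall (B : algfgCat K) (C : algCat K) (E : procat (algCat K))
      (e : mor _ (proA_of_fg B) (protensor K (proA_of C, E))),
    exists! e' : mor _ (proAfg_incl (FA (B, C))) E,
      e = protensor_map (idm (proA_of C)) e' \oc h B C.

Definition is_frakA (FA : frakA_type) (h : frakh_type FA) : Prop :=
  frakh_natural h /\ frakh_universal h.

End FrakA.

(** * Schemes and ind-schemes *)

Section Schemes.
Variable K : fieldType.

Definition schCat : category := opcat (algCat K).
Definition schfdCat : category := opcat (algfgCat K).
Definition indschCat : category := opcat (procat (algCat K)).
Definition indschfdCat : category := opcat (procat (algfgCat K)).

Definition Sfd_incl : functor schfdCat schCat := opF (incl (@fin_gen K)).
Definition IndSfd_incl : functor indschfdCat indschCat := opF (proAfg_incl K).

(* The points of the ind-scheme of a pro-algebra A are the pro-morphisms from A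
   to K. *)
Definition points (X : indschCat) : Type :=
  mor (procat (algCat K)) X (proA_of (GRing.regular K : ualgType K)).

(* The map on points induced by a mapping of ind-schemes, that is, by a
   pro-morphism in the opposite direction. *)
Definition points_map (X Y : indschCat) (m : mor indschCat X Y) (p : points X) :
    points Y :=
  @mcomp (procat (algCat K)) _ _ _ p m.

Definition frakM (FA : frakA_type K) :
    functor (prodcat (opcat schCat) schfdCat) indschfdCat :=
  dualF FA.

End Schemes.

Arguments frakA_type : clear implicits.
Arguments schCat : clear implicits.
Arguments schfdCat : clear implicits.
Arguments indschCat : clear implicits.
Arguments indschfdCat : clear implicits.
Arguments Sfd_incl : clear implicits.
Arguments IndSfd_incl : clear implicits.

(* Main.v *)
From HB Require Import structures.
Require Import Defs.
From mathcomp Require Import all_boot all_algebra.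
From mathcomp Require Import boolp classical_sets.

Set Implicit Arguments.
Unset Strict Implicit.
Unset Printing Implicit Defensive.

Import GRing.Theory.
Local Open Scope ring_scope.
Local Open Scope classical_set_scope.

(** The only real content is the existence of frakA; everything else is the
    universal property read twice.

    Fix a finitely generated algebra B and an algebra C.  Since morphisms of
    pro-algebras are computed componentwise in the target, the universal
    property of frakA(B, C) says exactly that the functor E |-> Hom(B, C (x) E)
    on algebras is the filtered colimit of representable functors Hom(A_i, E),
    with the A_i finitely generated.  The index i runs over the tight maps
    e : B -> C (x) A, those for which A is generated by the coefficients
    (phi (x) id)(e b), where b ranges over B and phi over the linear forms on C.

    - Over a field, linear forms on C separate the elements of C (x) A and
      detect whether such an element comes from C (x) S, for S a subspace of A
      (slices_generate, slice_ext).  They exist in sufficient supply by Zorn's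
      lemma (separating_form).
    - Hence a morphism out of A is determined by its effect on e (tight_ext), so
      the tight maps form a preordered set, not just a category; and A is
      finitely generated because B is (tight_fin_gen).
    - Every map B -> C (x) E factors through a tight one, on the subalgebra of E
      generated by its coefficients (tight_factor).  Applied to the map into
      C (x) (A1 x A2) given by two tight maps, this shows that the preorder is
      directed (tm_directed); for arbitrary E, together with tight_ext, it is
      the required colimit formula, from which frakA_h_universal follows.
    - A finitely generated algebra has a copy whose elements are among the formal
      combinations of words over nat (small_model), so that the tight maps to be
      considered form a set rather than a proper class.

    Functoriality and naturality are then forced by the universal property,
    because finitely generated algebras form a full subcategory and so do
    the pro-objects in them (pro_incl_full, pro_incl_faithful).

    For the bijection, take E = K in the universal property: the points of the
    ind-scheme of frakA(B, C) correspond to the pro-morphisms B -> C (x) K, hence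
    to the morphisms B -> C, because C is isomorphic to C (x) K
    (prorunitor_bijective).  For naturality, two points are compared through
    their composites with frak h (point_uniq). *)

(** * Linear forms and slices of tensors *)

Section Subspaces.
Variables (K : fieldType) (U : lmodType K).

Definition linclosed (S : set U) : Prop :=
  forall a x y, S x -> S y -> S (a *: x + y).

Lemma linclosed_sub S x y : linclosed S -> S x -> S y -> S (x - y).
Proof. by move=> lS Sx Sy; rewrite addrC -scaleN1r; apply: lS. Qed.

Lemma linclosed0 S x : linclosed S -> S x -> S 0.
Proof. by move=> lS Sx; rewrite -(subrr x); apply: linclosed_sub. Qed.

Lemma linclosed_scale S a x : linclosed S -> S x -> S (a *: x).
Proof.
by move=> lS Sx; rewrite -[_ *: _]addr0; apply: lS (linclosed0 lS Sx).
Qed.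

Lemma linclosed_add S x y : linclosed S -> S x -> S y -> S (x + y).
Proof. by move=> lS Sx Sy; rewrite -[x]scale1r; apply: lS. Qed.

Lemma linclosed_sum S (I : eqType) (r : seq I) (F : I -> U) :
  linclosed S -> S 0 -> (forall i, i \in r -> S (F i)) ->
  S (\sum_(i <- r) F i).
Proof.
move=> lS S0 SF; rewrite big_seq; elim/big_rec: _ => // i x ir Sx.
by apply: linclosed_add => //; apply: SF.
Qed.

(** A subspace M maximal among those that contain S but not c is a hyperplane
    complementary to the line through c; the form is the coordinate along c. *)
Lemma separating_form (S : set U) (c : U) : linclosed S -> S 0 -> ~ S c ->
  exists f : U -> GRing.regular K,
    [/\ linear f, forall x, S x -> f x = 0 & f c = 1].
Proof.
move=> lS S0 Sc.
(* Taking the union with S makes the empty chain satisfy P, as Zorn_bigcup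
   demands. *)
pose P (X : set U) := linclosed (X `|` S) /\ ~ X c.
have [F FP Ftot|X [[lX Xc] Xmax]] := @Zorn_bigcup U P.
  split; last by move=> [X /FP [_ ?]].
  have key X a x y : F X -> (X `|` S) x -> (X `|` S) y ->
      (\bigcup_(X in F) X `|` S) (a *: x + y).
    move=> FX Xx Xy; have [lX _] := FP _ FX.
    by case: (lX a x y Xx Xy) => h; [left; exists X|right].
  move=> a x y [[X FX Xx]|Sx] [[Y FY Yy]|Sy]; last by right; apply: lS.
  - case: (Ftot _ _ FX FY) => [XY|YX].
      by apply: (key Y) => //; left => //; apply: XY.
    by apply: (key X) => //; left => //; apply: YX.
  - by apply: (key X) => //; [left|right].
  - by apply: (key Y) => //; [right|left].
set M := X `|` S in lX.
have Mc : ~ M c by case.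
have M0 : M 0 by right.
have split_c x : exists a, M (x - a *: c).
  case: (pselect (M x)) => [Mx|Mx]; first by exists 0; rewrite scale0r subr0.
  pose Y := [set y | exists a m, M m /\ y = a *: x + m].
  have MY : M `<=` Y by move=> m Mm; exists 0, m; rewrite scale0r add0r.
  have XY : X `<` Y.
    split=> [z Xz|YX]; first by apply: MY; left.
    apply: Mx; left; apply: YX; exists 1, 0; split=> //.
    by rewrite scale1r addr0.
  have [//|/not_andP[[]|/contrapT[a [m [Mm cE]]]]] := pselect (P Y).
  - by move/Xmax : XY.
  - have -> : Y `|` S = Y by apply: setUidl => z Sz; apply: MY; right.
    move=> a _ _ [b [m [Mm ->]]] [b' [m' [Mm' ->]]].
    exists (a * b + b'), (a *: m + m'); split; first exact: lX.
    by rewrite scalerDr scalerA scalerDl addrACA.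
  - have a0 : a != 0.
      by apply: contra_not_neq Mc => a0; rewrite cE a0 scale0r add0r.
    exists a^-1; rewrite cE scalerDr scalerA mulVf // scale1r opprD addNKr.
    by rewrite -scaleNr; apply: linclosed_scale.
pose f x := projT1 (cid (split_c x)).
have fP x : M (x - f x *: c) by exact: (projT2 (cid (split_c x))).
have uniq x a b : M (x - a *: c) -> M (x - b *: c) -> a = b.
  move=> Ma Mb; apply/eqP; rewrite -subr_eq0; apply: contra_notT Mc => ab.
  rewrite -[c]scale1r -(mulVf ab) -scalerA; apply: linclosed_scale => //.
  have -> : (a - b) *: c = (x - b *: c) - (x - a *: c).
    by rewrite opprB [RHS]addrC addrA subrK scalerBl.
  exact: linclosed_sub.
exists f; split=> [a x y|x Sx|].
- apply: uniq (fP _) _; have := lX a _ _ (fP x) (fP y).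
  by rewrite scalerBr scalerA addrACA -opprD -scalerDl.
- by apply: uniq (fP _) _; rewrite scale0r subr0; right.
- by apply: uniq (fP _) _; rewrite scale1r subrr.
Qed.

End Subspaces.

Section Slices.
Variables (K : fieldType) (U V : lmodType K).
Implicit Types (phi : U -> GRing.regular K) (x y : tensor U V) (S : set V).

Definition slice phi : tensor U V -> V :=
  tlift (fun u v => (phi u : K) *: v).

Lemma slice_bilinear phi : linear phi ->
  is_bilinear (fun (u : U) (v : V) => (phi u : K) *: v).
Proof.
move=> lphi; split=> [v a u u'|u a v v'].
  by rewrite lphi scalerDl scalerA.
by rewrite scalerDr !scalerA mulrC.
Qed.

Lemma slice_linear phi : linear phi -> linear (slice phi).
Proof. by move=> lphi; apply: tlift_linear (slice_bilinear lphi). Qed.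

Lemma slice_pure phi u v : linear phi ->
  slice phi (tpure u v) = (phi u : K) *: v.
Proof. by move=> lphi; apply: tlift_pure (slice_bilinear lphi). Qed.

Lemma slice_tcl phi (s : seq (U * V)) : linear phi ->
  slice phi (tcl s) = \sum_(p <- s) (phi p.1 : K) *: p.2.
Proof. by move=> lphi; apply: tval_rep (slice_bilinear lphi). Qed.

(** By induction on the length of an expression of x as a sum of pure tensors.
    If the left factor c of the first term depends linearly on the others, that
    term can be absorbed into them.  Otherwise a form that is 1 at c and vanishes
    on the others has as its slice the right factor e, so that e lies in S and
    the first term may be removed. *)
Lemma slices_generate S (x : tensor U V) : linclosed S -> S 0 ->
  (forall phi, linear phi -> S (slice phi x)) ->
  exists2 t, x = tcl t & forall p, p \in t -> S p.2.
Proof.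
move=> lS S0; rewrite -{1 2}(tclK x); move: (trep x) => s {x}.
have [n] := ubnP (size s); elim: n s => // n IH [|[c e] s] /= sn hS.
  by exists [::].
pose z i := nth ((0, 0) : U * V) s i.
pose span := [set u | exists a : nat -> K,
                        u = \sum_(0 <= i < size s) a i *: (z i).1].
have lspan : linclosed span.
  move=> a _ _ [b ->] [b' ->]; exists (fun i => a * b i + b' i).
  rewrite scaler_sumr -big_split; apply: eq_bigr => i _.
  by rewrite scalerDl scalerA.
have span0 : span 0.
  by exists (fun=> 0); rewrite big1 // => i _; rewrite scale0r.
have [[a cE]|cspan] := pselect (span c).
  pose t := [seq ((z i).1, (z i).2 + a i *: e) | i <- index_iota 0 (size s)].
  have tE : tcl ((c, e) :: s) = tcl t.
    apply/tclE => W f [fl fr].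
    have f0 v : f 0 v = 0.
      by have := fl v (-1) 0 0; rewrite scaler0 addr0 scaleN1r addNr.
    have fsum v r (b : nat -> K) (y : nat -> U) :
        f (\sum_(i <- r) b i *: y i) v = \sum_(i <- r) b i *: f (y i) v.
      elim: r => [|i r IHr]; first by rewrite !big_nil.
      by rewrite !big_cons fl IHr.
    rewrite /Defs.tval /t big_map big_cons /= cE fsum.
    rewrite [in X in _ + X](big_nth (0, 0)).
    rewrite -big_split /=; apply: eq_bigr => i _.
    by rewrite [(z i).2 + _]addrC fr.
  rewrite tE; apply: IH; first by rewrite size_map size_iota subn0.
  by move=> phi lphi; rewrite -tE; apply: hS.
have [phi [lphi phi0 phic]] := separating_form lspan span0 cspan.
have phis p : p \in s -> phi p.1 = 0.
  move=> ps; apply: phi0; exists (fun i => (i == index p s)%:R).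
  rewrite big_mkord (bigD1 (Ordinal (etrans (index_mem p s) ps))) //= eqxx.
  rewrite scale1r /z nth_index // big1 ?addr0 // => i /negbTE.
  by rewrite -val_eqE /= => ->; rewrite scale0r.
have Se : S e.
  have := hS _ lphi; rewrite slice_tcl // big_cons /= phic scale1r.
  rewrite big_seq big1 ?addr0 // => p /phis ->; exact: scale0r.
have [|psi lpsi|t tE St] := IH s; first exact: sn.
  have := hS _ lpsi; rewrite !slice_tcl // big_cons /= => h.
  rewrite -[\sum_(_ <- _) _](addKr ((psi c : K) *: e)) addrC.
  by apply: linclosed_sub h _ => //; apply: linclosed_scale.
exists ((c, e) :: t); last by move=> p; rewrite inE => /orP[/eqP -> //|/St].
apply/tclE => W f bf; have /tclE/(_ W f bf) := tE.
by rewrite /Defs.tval !big_cons => ->.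
Qed.

Lemma tcl_sum (t : seq (U * V)) :
  tcl t = \sum_(p <- t) tpure p.1 p.2.
Proof.
apply/tensor_eqP => W f bf; rewrite tval_rep //.
have := tlift_linear bf; rewrite -/(tlift f _) => lf.
elim: t => [|p t IH]; first by rewrite big_nil /tlift tval_zero // tval_nil.
rewrite big_cons -[tpure _ _]scale1r lf scale1r -IH tlift_pure //.
by rewrite /Defs.tval big_cons.
Qed.

Lemma slice_ext x y : (forall phi, linear phi -> slice phi x = slice phi y) ->
  x = y.
Proof.
move=> e; have [|||t tE t0] := @slices_generate [set 0] (x - y).
- by move=> a u v /= -> ->; rewrite scaler0 addr0.
- by [].
- move=> phi lphi /=; rewrite addrC -scaleN1r slice_linear // e //.
  by rewrite scaleN1r addNr.
apply: subr0_eq; rewrite tE tcl_sum big_seq big1 // => p /t0 /= ->.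
by have [_ /(_ p.1 (-1) 0 0)] := tpure_bilinear U V;
  rewrite scaler0 addr0 scaleN1r addNr.
Qed.

End Slices.

(** * Subalgebras *)

Section Subalgebras.
Variable K : fieldType.
Implicit Types A B : ualgType K.

Definition subalgebra A (S : set A) : Prop :=
  [/\ S aone, linclosed S & forall x y, S x -> S y -> S (x ** y)].

Definition generated A (G : set A) : set A :=
  [set x | forall S, subalgebra S -> G `<=` S -> S x].

Lemma subalgebra0 A (S : set A) : subalgebra S -> S 0.
Proof. by move=> [S1 lS _]; apply: linclosed0 S1. Qed.

Lemma generatedS A (G : set A) : subalgebra (generated G).
Proof.
split=> [S []|a x y Gx Gy S SS GS|x y Gx Gy S SS GS] //; have [_ lS mS] := SS.
  by apply: lS; [apply: Gx|apply: Gy].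
by apply: mS; [apply: Gx|apply: Gy].
Qed.

Lemma generated_sub A (G : set A) : G `<=` generated G.
Proof. by move=> x Gx S _; apply. Qed.

Lemma generated_min A (G S : set A) :
  subalgebra S -> G `<=` S -> generated G `<=` S.
Proof. by move=> SS GS x; apply. Qed.

Lemma preimage_subalgebra A B (f : alg_hom A B) (S : set B) :
  subalgebra S -> subalgebra (f @^-1` S).
Proof.
move=> [S1 lS mS]; split=> [|a x y Sx Sy|x y Sx Sy] /=.
- by rewrite alg_one.
- by rewrite alg_lin; apply: lS.
- by rewrite alg_mul; apply: mS.
Qed.

Lemma image_subalgebra A B (f : alg_hom A B) (S : set A) :
  subalgebra S -> subalgebra (f @` S).
Proof.
move=> [S1 lS mS]; split=> [|a _ _ [x Sx <-] [y Sy <-]|_ _ [x Sx <-] [y Sy <-]].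
- by exists aone => //; apply: alg_one.
- by rewrite -alg_lin; exists (a *: x + y) => //; apply: lS.
- by rewrite -alg_mul; exists (x ** y) => //; apply: mS.
Qed.

Lemma range_subalgebra A B (f : alg_hom A B) : subalgebra (range f).
Proof. by apply: image_subalgebra; split. Qed.

Lemma equalizer_subalgebra A B (f g : alg_hom A B) :
  subalgebra [set x | f x = g x].
Proof.
split=> [|a x y /= fx fy|x y /= fx fy] /=.
- by rewrite !alg_one.
- by rewrite !alg_lin fx fy.
- by rewrite !alg_mul fx fy.
Qed.

Lemma fin_genP A : fin_gen A <->
  exists s : seq A, generated [set x | x \in s] = setT.
Proof.
split=> -[s sP]; exists s.
  apply/seteqP; split=> // x _ S [S1 lS mS] sS.
  pose S' : {pred A} := fun y => `[< S y >].
  have S'P y : y \in S' <-> S y by split=> /asboolP.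
  apply/S'P/sP; last by move=> y ys; apply/S'P/sS.
  split=> [|a y z /S'P Sy /S'P Sz|y z /S'P Sy /S'P Sz]; apply/S'P => //.
    exact: lS.
  exact: mS.
move=> S [S1 lS mS] sS x.
have /(_ [set y | y \in S]) : generated [set x | x \in s] x by rewrite sP.
apply; last by move=> y /sS.
by split.
Qed.

Lemma alg_hom0 A B (f : alg_hom A B) : f 0 = 0.
Proof.
by rewrite -[0 in LHS](subrr 0) addrC -scaleN1r alg_lin scaleN1r addNr.
Qed.

Lemma alg_hom_sum A B (f : alg_hom A B) (I : Type) (r : seq I) (F : I -> A) :
  f (\sum_(i <- r) F i) = \sum_(i <- r) f (F i).
Proof.
apply: (big_morph f _ (alg_hom0 f)) => x y.
by have := alg_lin f 1 x y; rewrite !scale1r.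
Qed.

(** An injection f onto a subalgebra turns X into an algebra.  This serves for
    realising a subalgebra as an algebra, and for doing so on a carrier X chosen
    in advance.  The proofs are parameters of the carrier so that the algebra
    structure can be recovered from it. *)
Definition image_alg A (X : choiceType) (f : X -> A) of injective f &
  subalgebra (range f) : Type := X.

Section ImageAlgebra.
Variables (A : ualgType K) (X : choiceType) (f : X -> A).
Hypotheses (f_inj : injective f) (fS : subalgebra (range f)).

Let pick (a : A) (fa : range f a) : X := projT1 (cid2 fa).
Let pickK a fa : f (@pick a fa) = a.
Proof. by rewrite /pick; case: cid2. Qed.

Let Smul x y : range f (f x ** f y).
Proof. by have [_ _ mS] := fS; exact: mS (imageT f x) (imageT f y). Qed.
Let Slin a x y : range f (a *: f x + f y).
Proof. by have [_ lS _] := fS; exact: lS (imageT f x) (imageT f y). Qed.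
Let Sone : range f aone. Proof. by case: fS. Qed.

Let one := pick Sone.
Let zero := pick (subalgebra0 fS).
Let lin a x y := pick (Slin a x y).
Let mul x y := pick (Smul x y).
Let add x y := lin 1 x y.
Let scale a x := lin a x zero.
Let opp x := scale (-1) x.

Let f1 : f one = aone. Proof. exact: pickK. Qed.
Let f0 : f zero = 0. Proof. exact: pickK. Qed.
Let fM x y : f (mul x y) = f x ** f y. Proof. exact: pickK. Qed.
Let fD x y : f (add x y) = f x + f y.
Proof. by rewrite [LHS]pickK scale1r. Qed.
Let fZ a x : f (scale a x) = a *: f x.
Proof. by rewrite [LHS]pickK f0 addr0. Qed.
Let fN x : f (opp x) = - f x. Proof. by rewrite fZ scaleN1r. Qed.

Local Notation XA := (image_alg f_inj fS).
HB.instance Definition _ := Choice.copy XA X.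

Let addA : associative (add : XA -> XA -> XA).
Proof. by move=> x y z; apply: f_inj; rewrite !fD addrA. Qed.
Let addC : commutative (add : XA -> XA -> XA).
Proof. by move=> x y; apply: f_inj; rewrite !fD addrC. Qed.
Let add0 : left_id (zero : XA) add.
Proof. by move=> x; apply: f_inj; rewrite fD f0 add0r. Qed.
Let addN : left_inverse (zero : XA) opp add.
Proof. by move=> x; apply: f_inj; rewrite fD fN f0 addNr. Qed.
HB.instance Definition _ := GRing.isZmodule.Build XA addA addC add0 addN.

Let scaleA a b (x : XA) : scale a (scale b x) = scale (a * b) x.
Proof. by apply: f_inj; rewrite !fZ scalerA. Qed.
Let scale1 : left_id 1 (scale : K -> XA -> XA).
Proof. by move=> x; apply: f_inj; rewrite fZ scale1r. Qed.
Let scaleDr : right_distributive (scale : K -> XA -> XA) +%R.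
Proof. by move=> a x y; apply: f_inj; rewrite !(fZ, fD) scalerDr. Qed.
Let scaleDl (x : XA) : {morph (fun a => scale a x : XA) : a b / a + b}.
Proof. by move=> a b; apply: f_inj; rewrite [RHS]fD !fZ scalerDl. Qed.
HB.instance Definition _ :=
  GRing.Zmodule_isLmodule.Build K XA scaleA scale1 scaleDr scaleDl.

Let mulA : associative (mul : XA -> XA -> XA).
Proof. by move=> x y z; apply: f_inj; rewrite !fM amulA. Qed.
Let mul1 : left_id (one : XA) mul.
Proof. by move=> x; apply: f_inj; rewrite fM f1 amul1x. Qed.
Let mulx1 : right_id (one : XA) mul.
Proof. by move=> x; apply: f_inj; rewrite fM f1 amulx1. Qed.
Let f_lin a (x y : XA) : f (a *: x + y) = a *: f x + f y.
Proof. by rewrite [LHS]fD fZ. Qed.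
Let mul_linl (y : XA) : linear ((fun x => mul x y) : XA -> XA).
Proof. by move=> a x x'; apply: f_inj; rewrite f_lin !fM f_lin amul_linl. Qed.
Let mul_linr (x : XA) : linear (mul x : XA -> XA).
Proof. by move=> a y y'; apply: f_inj; rewrite f_lin !fM f_lin amul_linr. Qed.
HB.instance Definition _ := Lmodule_isUAlgebra.Build K XA
  mulA mul1 mulx1 mul_linl mul_linr.

Definition image_ualg : ualgType K := XA.
Definition image_incl : alg_hom image_ualg A :=
  @AlgHom K image_ualg A f f_lin f1 fM.

End ImageAlgebra.
End Subalgebras.

(** * The zero algebra and products *)

Section ZeroAlgebra.
Variable K : fieldType.
Local Notation Z := ('rV[K]_0)%type.

Let zmul (_ _ : Z) : Z := 0.
Let zmulA : associative zmul. Proof. by []. Qed.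
Let zmul1 : left_id 0 zmul. Proof. by move=> x; rewrite [x]thinmx0. Qed.
Let zmulx1 : right_id 0 zmul. Proof. by move=> x; rewrite [x]thinmx0. Qed.
Let zmul_linl (y : Z) : linear (zmul^~ y).
Proof. by move=> a x x'; rewrite /zmul scaler0 addr0. Qed.
Let zmul_linr (x : Z) : linear (zmul x).
Proof. by move=> a y y'; rewrite /zmul scaler0 addr0. Qed.
HB.instance Definition _ := Lmodule_isUAlgebra.Build K Z
  zmulA zmul1 zmulx1 zmul_linl zmul_linr.
Definition zero_alg : ualgType K := Z.
Lemma zero_algP (x y : zero_alg) : x = y.
Proof. by rewrite (thinmx0 x) (thinmx0 y). Qed.
End ZeroAlgebra.

Section Product.
Variables (K : fieldType) (A B : ualgType K).
Local Notation P := (A * B)%type.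
Let pmul (x y : P) : P := (x.1 ** y.1, x.2 ** y.2).
Let pmulA : associative pmul. Proof. by move=> x y z; rewrite /pmul !amulA. Qed.
Let pmul1 : left_id (aone, aone) pmul.
Proof. by move=> [x y]; rewrite /pmul !amul1x. Qed.
Let pmulx1 : right_id (aone, aone) pmul.
Proof. by move=> [x y]; rewrite /pmul !amulx1. Qed.
Let pmul_linl (y : P) : linear (pmul^~ y).
Proof. by move=> a x x'; rewrite /pmul /= !amul_linl. Qed.
Let pmul_linr (x : P) : linear (pmul x).
Proof. by move=> a y y'; rewrite /pmul /= !amul_linr. Qed.
HB.instance Definition _ := Lmodule_isUAlgebra.Build K P
  pmulA pmul1 pmulx1 pmul_linl pmul_linr.

Definition prod_fst : alg_hom P A :=
  @AlgHom K P A fst (fun _ _ _ => erefl) erefl (fun _ _ => erefl).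
Definition prod_snd : alg_hom P B :=
  @AlgHom K P B snd (fun _ _ _ => erefl) erefl (fun _ _ => erefl).

Program Definition prod_tuple (D : ualgType K) (f : alg_hom D A)
    (g : alg_hom D B) : alg_hom D P :=
  @AlgHom K D P (fun d => (f d, g d)) _ _ _.
Next Obligation. by move=> a x y; rewrite !alg_lin. Qed.
Next Obligation. by rewrite !alg_one. Qed.
Next Obligation. by move=> x y; rewrite !alg_mul. Qed.
End Product.

(** * Small copies of finitely generated algebras *)

Section SmallModels.
Variable K : fieldType.

(** Formal linear combinations of words in the letters 0, 1, 2, and so on.  No
    relations are imposed, so this is not the free algebra; it only supplies
    enough names for the elements of a finitely generated algebra. *)
Definition ncpoly := seq (K * seq nat).

(** The algebras whose carrier is a subset of ncpoly form a set, unlike all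
    algebras, and can therefore enter an index set. *)
Definition small_alg := {P : pred ncpoly & UAlgebra.axioms_ K {t | P t}}.
Definition small_ualg (M : small_alg) : ualgType K := UAlgebra.Pack (projT2 M).

Variables (A : ualgType K) (s : seq A).

(* Letters beyond the size of s evaluate to 0. *)
Definition nceval_word (w : seq nat) : A :=
  foldr (fun k x => nth 0 s k ** x) aone w.
Definition nceval (t : ncpoly) : A :=
  \sum_(p <- t) p.1 *: nceval_word p.2.

Lemma nceval_word_cat u w :
  nceval_word (u ++ w) = nceval_word u ** nceval_word w.
Proof. by elim: u => [|k u IH] /=; rewrite ?amul1x // IH amulA. Qed.

Lemma nceval_subalgebra : subalgebra (range nceval).
Proof.
split=> [|a _ _ [x _ <-] [y _ <-]|_ _ [x _ <-] [y _ <-]].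
- by exists [:: (1, [::])]; rewrite // /nceval big_seq1 scale1r.
- exists ([seq (a * p.1, p.2) | p <- x] ++ y) => //.
  rewrite /nceval big_cat big_map scaler_sumr; congr (_ + _).
  by apply: eq_bigr => p _; rewrite scalerA.
- exists [seq (p.1 * q.1, p.2 ++ q.2) | p <- x, q <- y] => //.
  rewrite /nceval big_allpairs_dep amul_suml; apply: eq_bigr => p _ /=.
  rewrite amul_sumr; apply: eq_bigr => q _ /=.
  by rewrite nceval_word_cat -ascaleAl -ascaleAr scalerA.
Qed.

Lemma range_nceval : range nceval = generated [set x | x \in s].
Proof.
apply/seteqP; split=> [_ [t _ <-] S SS sS|].
  have [S1 lS mS] := SS; have S0 := subalgebra0 SS.
  apply: linclosed_sum => // -[a w] _; apply: linclosed_scale => //=.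
  elim: w => [|k w IH] //=; apply: mS => //.
  have [ks|sk] := ltnP k (size s); first exact/sS/mem_nth.
  by rewrite nth_default.
apply: generated_min nceval_subalgebra _ => x xs.
exists [:: (1, [:: index x s])] => //.
by rewrite /nceval big_seq1 /= scale1r amulx1 nth_index.
Qed.

(* choose only depends on the extension of the predicate, so canon t is a name
   of the value of t that is the same for all names of that value. *)
Let canon (t : ncpoly) : ncpoly := choose [pred u | nceval u == nceval t] t.

Let canonK t : nceval (canon t) = nceval t.
Proof.
by apply/eqP; apply: (@chooseP _ [pred u | nceval u == nceval t]) => /=.
Qed.

Let canon_eq t u : nceval t = nceval u -> canon t = canon u.
Proof.
move=> e; rewrite /canon (@eq_choose _ _ [pred v | nceval v == nceval u]).
  by apply: choose_id => /=; rewrite ?e.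
by move=> v; rewrite /= e.
Qed.

Lemma small_model : exists (M : small_alg) (i : alg_hom (small_ualg M) A),
  injective i /\ range i = generated [set x | x \in s].
Proof.
pose f (x : {t | canon t == t}) := nceval (val x).
have f_inj : injective f.
  move=> x y e; apply: val_inj; rewrite -(eqP (valP x)) -(eqP (valP y)).
  exact: canon_eq.
have fE : range f = range nceval.
  apply/seteqP; split=> [_ [x _ <-]|_ [t _ <-]]; first by exists (val x).
  have cP : canon (canon t) == canon t by apply/eqP/canon_eq/canonK.
  by exists (exist _ (canon t) cP) => //; rewrite /f /= canonK.
have fS : subalgebra (range f) by rewrite fE; exact: nceval_subalgebra.
exists (existT (fun P : pred ncpoly => UAlgebra.axioms_ K {t | P t})
  (fun t => canon t == t) (UAlgebra.class (image_ualg f_inj fS))).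
by exists (image_incl f_inj fS); rewrite -range_nceval -fE.
Qed.

End SmallModels.

(** * Coefficients and tight maps *)

Section Coefficients.
Variable K : fieldType.
Implicit Types A B C E : ualgType K.

Lemma slice_tmap C A E (f : alg_hom A E) phi (x : tensor C A) : linear phi ->
  slice phi (tmap (alg_id C) f x) = f (slice phi x).
Proof.
move=> lphi; apply: (@tensor_ext _ _ _ _
  (fun x => slice phi (tmap (alg_id C) f x)) (fun x => f (slice phi x))) => {x} [a x y|a x y|u v].
- by rewrite alg_lin slice_linear.
- by rewrite slice_linear // alg_lin.
rewrite tmap_pure !slice_pure //=.
by have := alg_lin f (phi u) v 0; rewrite !addr0 alg_hom0 addr0.
Qed.

Lemma tmap_inj C A E (f : alg_hom A E) : injective f ->
  injective (tmap (alg_id C) f).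
Proof.
move=> f_inj x y e; apply: slice_ext => phi lphi; apply: f_inj.
by rewrite -!slice_tmap // e.
Qed.

Lemma tmap_idK C A E E' (g : alg_hom E E') (f : alg_hom A E) (x : tensor C A) :
  tmap (alg_id C) g (tmap (alg_id C) f x) = tmap (alg_id C) (alg_comp g f) x.
Proof.
have -> : tmap (alg_id C) (alg_comp g f) =
          alg_comp (tmap (alg_id C) g) (tmap (alg_id C) f).
  by rewrite -tmap_comp; congr tmap; apply: alg_hom_ext.
by [].
Qed.

(** For a subspace S this is the image of C (x) S in C (x) A, by
    slices_generate; stating it with slices avoids the tensor product with S. *)
Definition tensor_in C A (S : set A) : set (tensor C A) :=
  [set x | forall phi, linear phi -> S (slice phi x)].

Lemma tensor_in_pure C A (S : set A) c a : linclosed S -> S 0 -> S a ->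
  tensor_in S (tpure c a : tensor C A).
Proof.
by move=> lS S0 Sa phi lphi; rewrite slice_pure //; apply: linclosed_scale.
Qed.

Lemma tensor_in_linclosed C A (S : set A) : linclosed S ->
  linclosed (tensor_in S : set (tensor C A)).
Proof.
by move=> lS a x y Sx Sy phi lphi; rewrite slice_linear //; apply: lS; auto.
Qed.

Lemma tensor_in_subalgebra C A (S : set A) :
  subalgebra S -> subalgebra (tensor_in S : set (tensor C A)).
Proof.
move=> SS; have [S1 lS mS] := SS; have S0 := subalgebra0 SS.
have lT := tensor_in_linclosed (C := C) lS.
have T0 : tensor_in S (0 : tensor C A).
  by apply: (linclosed0 lT (x := aone)); apply: tensor_in_pure.
split=> // [|x y Sx Sy]; first exact: tensor_in_pure.
have [s -> sS] := slices_generate lS S0 Sx.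
have [t -> tS] := slices_generate lS S0 Sy.
rewrite !tcl_sum amul_suml; apply: linclosed_sum => // p ps.
rewrite amul_sumr; apply: linclosed_sum => // q qt.
by rewrite tpureM; apply: tensor_in_pure => //; apply: mS; auto.
Qed.

Definition coefs B C A (e : alg_hom B (tensor C A)) : set A :=
  [set a | exists phi b, linear phi /\ a = slice phi (e b)].

Definition tight B C A (e : alg_hom B (tensor C A)) : Prop :=
  generated (coefs e) = setT.

Lemma tightW B C A (e : alg_hom B (tensor C A)) (S : set A) : tight e ->
  subalgebra S -> coefs e `<=` S -> forall a, S a.
Proof.
by move=> te SS cS a; apply: (generated_min SS cS); rewrite te.
Qed.

(** The elements on which f and g agree form a subalgebra, which contains the
    coefficients of e because slices commute with f and g. *)
Lemma tight_ext B C A E (e : alg_hom B (tensor C A)) (f g : alg_hom A E) :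
  tight e ->
  alg_comp (tmap (alg_id C) f) e = alg_comp (tmap (alg_id C) g) e -> f = g.
Proof.
move=> te fg; apply: alg_hom_ext; apply: tightW te (equalizer_subalgebra f g) _.
move=> _ [phi [b [lphi ->]]] /=; rewrite -!slice_tmap //.
by have /(congr1 (fun h : alg_hom _ _ => h b)) /= -> := fg.
Qed.

(** The b for which e b lies in C (x) S form a subalgebra of B, so generators
    suffice. *)
Lemma coefs_sub B C A (e : alg_hom B (tensor C A)) (s : seq B) (S : set A) :
  generated [set b | b \in s] = setT -> subalgebra S ->
  (forall b, b \in s -> tensor_in S (e b)) -> coefs e `<=` S.
Proof.
move=> sB SS se _ [phi [b [lphi ->]]].
have : generated [set b | b \in s] b by rewrite sB.
have eS := preimage_subalgebra e (tensor_in_subalgebra C SS).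
by move=> /(generated_min eS se); apply.
Qed.

(** For each generator b write e b as a sum of pure tensors whose right factors
    lie in the algebra generated by the coefficients; these finitely many right
    factors generate it. *)
Lemma coefs_fin_gen B C A (e : alg_hom B (tensor C A)) : fin_gen B ->
  exists s : seq A, generated [set a | a \in s] = generated (coefs e).
Proof.
move=> /fin_genP[s sB].
have SG := generatedS (coefs e); have [_ lG _] := SG.
have G0 := subalgebra0 SG.
have tP b : exists t, e b = tcl t /\ forall p, p \in t -> generated (coefs e) p.2.
  have [phi lphi|t] := slices_generate (x := e b) lG G0; last by exists t.
  by apply: generated_sub; exists phi, b.
pose t b := projT1 (cid (tP b)).
have tE b : e b = tcl (t b) /\ forall p, p \in t b -> generated (coefs e) p.2.
  exact: projT2 (cid (tP b)).
exists (flatten [seq [seq p.2 | p <- t b] | b <- s]).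
set u := flatten _; apply/seteqP; split; apply: generated_min => //.
- move=> a /flattenP[_ /mapP[b _ ->] /mapP[p pt ->]].
  by have [_] := tE b; apply.
- exact: generatedS.
have SU := generatedS [set a | a \in u]; have [_ lU _] := SU.
apply: (coefs_sub sB SU) => b bs phi lphi; have [-> _] := tE b.
rewrite slice_tcl //; apply: linclosed_sum => //; first exact: subalgebra0 SU.
move=> p pt; apply: (linclosed_scale _ lU); apply: generated_sub => /=.
by apply/flattenP; exists [seq q.2 | q <- t b]; apply: map_f.
Qed.

Lemma tight_fin_gen B C A (e : alg_hom B (tensor C A)) :
  fin_gen B -> tight e -> fin_gen A.
Proof.
by move=> /(coefs_fin_gen e)[s sE] te; apply/fin_genP; exists s; rewrite sE.
Qed.

Lemma alg_hom_lift A B M (e : alg_hom B A) (i : alg_hom M A) : injective i ->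
  range e `<=` range i -> exists e', e = alg_comp i e'.
Proof.
move=> i_inj ei; have gP b : exists m, i m = e b.
  by have [|m _ <-] := ei (e b); [exists b|exists m].
pose g b := projT1 (cid (gP b)).
have gE b : i (g b) = e b by exact: projT2 (cid (gP b)).
have g_lin : linear g by move=> a x y; apply: i_inj; rewrite alg_lin !gE alg_lin.
have g1 : g aone = aone by apply: i_inj; rewrite gE !alg_one.
have gM : {morph g : x y / x ** y}.
  by move=> x y; apply: i_inj; rewrite alg_mul !gE alg_mul.
by exists (AlgHom g_lin g1 gM); apply: alg_hom_ext => b /=; rewrite gE.
Qed.

(** M is a small copy of the subalgebra generated by the coefficients of e, and
    e lifts to C (x) M because C (x) - preserves injections over a field. *)
Lemma tight_factor B C E (e : alg_hom B (tensor C E)) : fin_gen B ->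
  exists (M : small_alg K) (e' : alg_hom B (tensor C (small_ualg M)))
    (i : alg_hom (small_ualg M) E),
    tight e' /\ e = alg_comp (tmap (alg_id C) i) e'.
Proof.
move=> fgB; have [s sE] := coefs_fin_gen e fgB.
have [M [i [i_inj iE]]] := small_model s; rewrite sE in iE.
have [_ lG _] := generatedS (coefs e).
have [_ [b _ <-]|e' eE] := alg_hom_lift (e := e) (tmap_inj (C := C) i_inj).
  have [|||t -> tG] := slices_generate (S := range i) (x := e b).
  - by rewrite iE.
  - by rewrite iE; apply: subalgebra0 (generatedS _).
  - by move=> phi lphi; rewrite iE; apply: generated_sub; exists phi, b.
  have [_ lR _] := range_subalgebra (tmap (alg_id C) i).
  rewrite tcl_sum; apply: linclosed_sum => //.
    by exists 0 => //; apply: alg_hom0.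
  move=> p /tG[a _ <-]; exists (tpure p.1 a) => //.
  by rewrite tmap_pure.
exists M, e', i; split=> //; apply/seteqP; split=> // m _ S SS cS.
have : (i @` S) (i m).
  have : generated (coefs e) (i m) by rewrite -iE; exists m.
  apply: generated_min; first exact: image_subalgebra.
  move=> _ [phi [b [lphi ->]]]; exists (slice phi (e' b)).
    by apply: cS; exists phi, b.
  by rewrite -slice_tmap // eE.
by case=> m' Sm' /i_inj <-.
Qed.

End Coefficients.

(** * The pro-algebra of tight maps *)

Section Representation.
Variable K : fieldType.

(** C (x) (A1 x A2) is the product of C (x) A1 and C (x) A2: the comparison map
    is injective by slices, and surjective by padding with zeros. *)
Lemma tensor_pairing (B C A1 A2 : ualgType K) (e1 : alg_hom B (tensor C A1))
    (e2 : alg_hom B (tensor C A2)) :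
  exists e : alg_hom B (tensor C (A1 * A2)%type),
    alg_comp (tmap (alg_id C) (prod_fst A1 A2)) e = e1 /\
    alg_comp (tmap (alg_id C) (prod_snd A1 A2)) e = e2.
Proof.
pose P1 := tmap (alg_id C) (prod_fst A1 A2).
pose P2 := tmap (alg_id C) (prod_snd A1 A2).
have [||e eE] := @alg_hom_lift K _ _ _ (prod_tuple e1 e2) (prod_tuple P1 P2).
- move=> x y [e1' e2']; apply: slice_ext => phi lphi.
  rewrite [LHS]surjective_pairing [RHS]surjective_pairing; congr pair.
    rewrite -[LHS](slice_tmap (prod_fst A1 A2) x lphi).
    by rewrite -[RHS](slice_tmap (prod_fst A1 A2) y lphi); congr slice.
  rewrite -[LHS](slice_tmap (prod_snd A1 A2) x lphi).
  by rewrite -[RHS](slice_tmap (prod_snd A1 A2) y lphi); congr slice.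
- move=> _ [b _ <-].
  pose s1 := [seq (p.1, (p.2, 0 : A2)) | p <- trep (e1 b)].
  pose s2 := [seq (p.1, (0 : A1, p.2)) | p <- trep (e2 b)].
  exists (tcl (s1 ++ s2)) => //; congr pair; apply: slice_ext => phi lphi.
    rewrite slice_tmap // slice_tcl // alg_hom_sum big_cat !big_map /=.
    rewrite [X in _ + X]big1 ?addr0 // => p _; exact: scaler0.
  rewrite slice_tmap // slice_tcl // alg_hom_sum big_cat !big_map /=.
  rewrite [X in X + _]big1 ?add0r // => p _; exact: scaler0.
exists e; split; apply: alg_hom_ext => b.
  by have /(congr1 (fun h : alg_hom _ _ => (h b).1)) := eE.
by have /(congr1 (fun h : alg_hom _ _ => (h b).2)) := eE.
Qed.

Variables (B : algfgCat K) (C : algCat K).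

Record tight_map := TightMap {
  tm_alg : small_alg K;
  tm_map : alg_hom (sval B) (tensor C (small_ualg tm_alg));
  tm_tight : tight tm_map }.

Definition push E E' (f : alg_hom E E') (e : alg_hom (sval B) (tensor C E)) :
    alg_hom (sval B) (tensor C E') :=
  alg_comp (tmap (alg_id C) f) e.

Lemma push_comp (E E' E'' : ualgType K) (g : alg_hom E' E'') (f : alg_hom E E')
    e :
  push (alg_comp g f) e = push g (push f e).
Proof. by apply: alg_hom_ext => b; exact: esym (tmap_idK _ _ _). Qed.

Lemma push_id (E : ualgType K) e : push (alg_id E) e = e.
Proof. by rewrite /push tmap_id; apply: alg_hom_ext. Qed.

(** The larger index is the source, as transition maps go down. *)
Definition tm_le (i j : tight_map) : Prop :=
  exists f : alg_hom (small_ualg (tm_alg j)) (small_ualg (tm_alg i)),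
    push f (tm_map j) = tm_map i.

Lemma tight_map_factor (E : ualgType K) (e : alg_hom (sval B) (tensor C E)) :
  exists (i : tight_map) (f : alg_hom (small_ualg (tm_alg i)) E),
    e = push f (tm_map i).
Proof.
have [M [e' [f [te' eE]]]] := tight_factor e (svalP B).
by exists (TightMap te'), f.
Qed.

Lemma tm_le_refl i : tm_le i i.
Proof. by exists (alg_id _); rewrite push_id. Qed.

Lemma tm_le_trans i j k : tm_le i j -> tm_le j k -> tm_le i k.
Proof. by move=> [f fE] [g gE]; exists (alg_comp f g); rewrite push_comp gE. Qed.

Lemma tm_inhabited : inhabited tight_map.
Proof.
pose T : ualgType K := tensor (C : ualgType K) (zero_alg K).
have T0 (x y : T) : x = y by apply: slice_ext => phi _; apply: zero_algP.
pose z (b : sval B) : T := 0.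
have z_lin : linear z by move=> a x y; apply: T0.
have zM : {morph z : x y / x ** y} by move=> x y; apply: T0.
have [i _] := tight_map_factor (AlgHom z_lin (T0 _ _) zM).
by exists.
Qed.

Lemma tm_directed i j : exists2 k, tm_le i k & tm_le j k.
Proof.
have [e [e1 e2]] := tensor_pairing (tm_map i) (tm_map j).
have [k [f fE]] := tight_map_factor e.
exists k; [exists (alg_comp (prod_fst _ _) f)|exists (alg_comp (prod_snd _ _) f)].
  by rewrite push_comp -fE.
by rewrite push_comp -fE.
Qed.

Definition tight_dirset : dirset :=
  Dirset tm_le_refl tm_le_trans tm_inhabited tm_directed.

Definition tm_ob (i : tight_dirset) : algfgCat K :=
  exist (@fin_gen K) (small_ualg (tm_alg i))
    (tight_fin_gen (svalP B) (tm_tight i)).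

Definition tm_tr (i j : tight_dirset) (h : dle i j) :
  mor (algfgCat K) (tm_ob j) (tm_ob i) := projT1 (cid h).

Lemma tm_trE i j (h : dle i j) : push (tm_tr h) (tm_map j) = tm_map i.
Proof. exact: projT2 (cid h). Qed.

Lemma tm_uniq (i : tight_map) (E : ualgType K)
    (f g : alg_hom (small_ualg (tm_alg i)) E) :
  push f (tm_map i) = push g (tm_map i) -> f = g.
Proof. exact: tight_ext (tm_tight i). Qed.

Lemma tm_tr_id i (h : dle i i) : tm_tr h = idm (tm_ob i).
Proof. by apply: tm_uniq; rewrite tm_trE push_id. Qed.

Lemma tm_tr_comp i j k (h : dle i j) (h' : dle j k) (h'' : dle i k) :
  mcomp (tm_tr h) (tm_tr h') = tm_tr h''.
Proof. by apply: tm_uniq; rewrite push_comp !tm_trE. Qed.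

Definition frakA_ob : procat (algfgCat K) := ProObj tm_tr_id tm_tr_comp.

(** Over a common upper bound k, the two composites have the same effect on the
    tight map k, hence coincide. *)
Lemma tm_germ_eq (E : algCat K) (i j : tight_dirset)
    (f : alg_hom (small_ualg (tm_alg i)) E)
    (g : alg_hom (small_ualg (tm_alg j)) E) :
  push f (tm_map i) = push g (tm_map j) ->
  @germ (algCat K) (proAfg_incl K frakA_ob) E i f =
  @germ (algCat K) (proAfg_incl K frakA_ob) E j g.
Proof.
move=> fg; apply/germP; have [k ik jk] := tm_directed i j.
exists k, ik, jk; apply: (@tm_uniq k E).
by rewrite !push_comp !tm_trE.
Qed.

Program Definition frakA_h : mor (procat (algCat K)) (proA_of_fg B)
    (protensor K (proA_of C, proAfg_incl K frakA_ob)) :=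
  @ProHom (algCat K) (proA_of_fg B)
    (protensor K (proA_of C, proAfg_incl K frakA_ob))
    (fun j => @germ (algCat K) (proA_of_fg B) (tensor C (small_ualg (tm_alg j.2)))
       tt (tm_map j.2)) _.
Next Obligation.
rewrite cpost_germ; congr germ; exact: tm_trE.
Qed.

End Representation.

Local Open Scope cat_scope.

Lemma const_germ_inj (C : category) (c d : C) (f g : mor C c d) :
  @germ C (constob c) d tt f = @germ C (constob c) d tt g -> f = g.
Proof. by move=> /germP[k [h [h' /=]]]; rewrite !compm1. Qed.

Lemma const_germP (C : category) (c d : C) (a : colim (constob c) d) :
  exists f : mor C c d, a = @germ C (constob c) d tt f.
Proof. by have [[] [f ->]] := colimP a; exists f. Qed.

(** * The universal property *)

Section Universal.
Variables (K : fieldType) (B : algfgCat K) (C : algCat K).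

Lemma protensor_map_germ (X X' Y Y' : procat (algCat K)) (f : mor _ X X')
    (g : mor _ Y Y') p i j (f' : mor (algCat K) (pob i) (X' p.1))
    (g' : mor (algCat K) (pob j) (Y' p.2)) :
  f p.1 = germ f' -> g p.2 = germ g' ->
  protensor_map f g p =
  @germ (algCat K) (protensor K (X, Y)) (tensor (X' p.1) (Y' p.2)) (i, j)
    (tmap f' g').
Proof.
by move=> /= -> ->; rewrite cpair_germ cmap_germ.
Qed.

Lemma frakA_h_germ (E : procat (algCat K))
    (e' : mor _ (proAfg_incl K (frakA_ob B C)) E) j i
    (f : alg_hom (small_ualg (tm_alg i)) (E j)) :
  e' j = @germ (algCat K) (proAfg_incl K (frakA_ob B C)) (E j) i f ->
  (protensor_map (idm (proA_of C)) e' \oc frakA_h B C) (tt, j) =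
  @germ (algCat K) (proA_of_fg B) (tensor (C : ualgType K) (E j)) tt
      (push f (tm_map i)).
Proof.
move=> e'E; rewrite [LHS](@procomp_funE (algCat K) _
  (protensor K (proA_of C, proAfg_incl K (frakA_ob B C)))
  (protensor K (proA_of C, E)) _ _ (tt, j) (tt, i) (tmap (alg_id C) f)).
  by rewrite cpost_germ.
exact: (@protensor_map_germ (proA_of C) (proA_of C)
  (proAfg_incl K (frakA_ob B C)) E (idm (proA_of C)) e' (tt, j) tt i (alg_id C) f
  erefl e'E).
Qed.

(** The component of e' at j is the germ of any f through which e_j factors via a
    tight map; by tm_germ_eq the germ does not depend on the factorisation, which
    gives compatibility in j as well as uniqueness. *)
Lemma frakA_h_universal (E : procat (algCat K))
    (e : mor _ (proA_of_fg B) (protensor K (proA_of C, E))) :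
  exists! e' : mor _ (proAfg_incl K (frakA_ob B C)) E,
    e = protensor_map (idm (proA_of C)) e' \oc frakA_h B C.
Proof.
have repr j : exists i (f : alg_hom (small_ualg (tm_alg i)) (E j)),
    e (tt, j) =
    @germ (algCat K) (proA_of_fg B) (tensor (C : ualgType K) (E j)) tt
      (push f (tm_map i)).
  have [u ->] := const_germP (e (tt, j)).
  by have [i [f ->]] := tight_map_factor u; exists i, f.
pose i j := projT1 (cid (repr j)).
pose f j := projT1 (cid (projT2 (cid (repr j)))).
have fE j : e (tt, j) =
    @germ (algCat K) (proA_of_fg B) (tensor (C : ualgType K) (E j)) tt
      (push (f j) (tm_map (i j))) by exact: projT2 (cid (projT2 (cid (repr j)))).
pose e' j : colim (proAfg_incl K (frakA_ob B C)) (E j) :=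
  @germ (algCat K) (proAfg_incl K (frakA_ob B C)) (E j) (i j) (f j).
have e'P j j' (h : dle j j') : cpost (ptr E h) (e' j') = e' j.
  rewrite /e' cpost_germ; apply: tm_germ_eq.
  apply: (@const_germ_inj (algCat K) (sval B) (tensor (C : ualgType K) (E j))).
  have hh : @dle (pidx (protensor K (proA_of C, E))) (tt, j) (tt, j') by split.
  rewrite -fE -(phf_compat e hh) fE cpost_germ push_comp.
  by rewrite (Prop_irrelevance h (proj2 hh)).
exists (ProHom e'P); split.
  by apply: prohom_ext => -[[] j]; rewrite (@frakA_h_germ _ _ j (i j) (f j)).
move=> e'' eE; apply: prohom_ext => j /=.
have [k [g gE]] := colimP (e'' j); rewrite gE; apply: tm_germ_eq.
apply: (@const_germ_inj (algCat K) (sval B) (tensor (C : ualgType K) (E j))).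
by rewrite -fE eE (frakA_h_germ gE).
Qed.

End Universal.

(** * The functor frakA *)

Section FullyFaithful.
Variables (C : category) (P : C -> Prop).
Variables (X Y : proobj (fullsub P)).

Lemma pro_incl_faithful (f g : mor (procat (fullsub P)) X Y) :
  fmap (proF (incl P)) f = fmap (proF (incl P)) g -> f = g.
Proof.
move=> fg; apply: prohom_ext => j.
have /= := congr1
  (fun u : prohom (proFob (incl P) X) (proFob (incl P) Y) => u j) fg.
have [i [u ->]] := colimP (f j); have [i' [v ->]] := colimP (g j).
by rewrite !cmap_germ => /germP uv; apply/germP.
Qed.

Lemma pro_incl_full
    (g : mor (procat C) (proF (incl P) X) (proF (incl P) Y)) :
  exists f : mor (procat (fullsub P)) X Y, fmap (proF (incl P)) f = g.
Proof.
pose f j : colim X (Y j) :=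
  @germ (fullsub P) X (Y j) (cidx (g j)) (crep (g j)).
have fE j : cmap (incl P) (f j) = g j by rewrite cmap_germ; apply: crepK.
have fP j j' (h : dle j j') : cpost (ptr Y h) (f j') = f j.
  rewrite cpost_germ; apply/germP.
  have : cpost (ptr (proF (incl P) Y) h) (g j') = g j := phf_compat g h.
  rewrite -{1}(crepK (g j')) cpost_germ -{1}(crepK (g j)) => /germP.
  exact.
by exists (ProHom fP); apply: prohom_ext => j; apply: fE.
Qed.

End FullyFaithful.

Section ProTensor.
Variable K : fieldType.
Local Notation A := (procat (algCat K)).

Lemma protensor_map_comp (X X' X'' Y Y' Y'' : A) (f' : mor A X' X'')
    (g' : mor A Y' Y'') (f : mor A X X') (g : mor A Y Y') :
  protensor_map (f' \oc f) (g' \oc g) =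
  protensor_map f' g' \oc protensor_map f g.
Proof.
exact: (@fmap_comp _ _ (protensor K) (X, Y) (X', Y') (X'', Y'') (f', g') (f, g)).
Qed.

Lemma protensor_map_id (X Y : A) :
  protensor_map (idm X) (idm Y) = idm (protensor K (X, Y)).
Proof. exact: (@fmap_id _ _ (protensor K) (X, Y)). Qed.

Lemma protensor_map_swap (X X' Y Y' : A) (f : mor A X X') (g : mor A Y Y') :
  protensor_map (idm X') g \oc protensor_map f (idm Y) =
  protensor_map f (idm Y') \oc protensor_map (idm X) g.
Proof. by rewrite -!protensor_map_comp !comp1m !compm1. Qed.

Lemma protensor_map_idl (X Y Y' Y'' : A) (g' : mor A Y' Y'') (g : mor A Y Y') :
  protensor_map (idm X) (g' \oc g) =
  protensor_map (idm X) g' \oc protensor_map (idm X) g.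
Proof. by rewrite -protensor_map_comp comp1m. Qed.

Lemma protensor_map_idr (X X' X'' Y : A) (f' : mor A X' X'') (f : mor A X X') :
  protensor_map (f' \oc f) (idm Y) =
  protensor_map f' (idm Y) \oc protensor_map f (idm Y).
Proof. by rewrite -protensor_map_comp comp1m. Qed.

End ProTensor.

Section Existence.
Variable K : fieldType.
Local Notation A := (procat (algCat K)).
Local Notation fgA := (prodcat (algfgCat K) (opcat (algCat K))).
Local Notation const := (fmap (constpro (algCat K))).

Definition frakA_cone (B B' : algfgCat K) (C C' : algCat K)
    (g : mor (algfgCat K) B B') (f : mor (algCat K) C' C) :=
  protensor_map (const f) (idm (proAfg_incl K (frakA_ob B' C')))
    \oc frakA_h B' C' \oc const (fmap (incl (@fin_gen K)) g).

(** Naturality of frak h at (g, f); by the universal property it has exactly one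
    solution F, which is how frakA is defined on morphisms. *)
Definition frakA_rel (B B' : algfgCat K) (C C' : algCat K)
    (g : mor (algfgCat K) B B') (f : mor (algCat K) C' C)
    (F : mor (procat (algfgCat K)) (frakA_ob B C) (frakA_ob B' C')) : Prop :=
  protensor_map (idm (proA_of C)) (fmap (proAfg_incl K) F) \oc frakA_h B C =
  frakA_cone g f.

Lemma frakA_rel_exists B B' C C' g f : exists F, @frakA_rel B B' C C' g f F.
Proof.
have [e' [eE _]] := frakA_h_universal (frakA_cone g f).
by have [F FE] := pro_incl_full e'; exists F; rewrite /frakA_rel eE -FE.
Qed.

Lemma frakA_rel_uniq B B' C C' g f F F' :
  @frakA_rel B B' C C' g f F -> frakA_rel g f F' -> F = F'.
Proof.
move=> hF hF'; apply: pro_incl_faithful.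
have [e' [_ e'U]] := frakA_h_universal (frakA_cone g f).
by rewrite -(e'U _ (esym hF)) -(e'U _ (esym hF')).
Qed.

Lemma frakA_rel_id B C : frakA_rel (idm B) (idm C) (idm (frakA_ob B C)).
Proof.
by rewrite /frakA_rel /frakA_cone !fmap_id !protensor_map_id compm1.
Qed.

Lemma frakA_rel_comp B B' B'' C C' C'' g f g' f' F F' :
  @frakA_rel B B' C C' g f F -> @frakA_rel B' B'' C' C'' g' f' F' ->
  frakA_rel (g' \oc g) (f \oc f') (F' \oc F).
Proof.
rewrite /frakA_rel /frakA_cone => hF hF'.
rewrite !fmap_comp protensor_map_idl -Defs.compA hF !Defs.compA protensor_map_swap.
by rewrite protensor_map_idr -(Defs.compA _ _ (frakA_h B' C')) hF' !Defs.compA.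
Qed.

Definition frakA_map (p q : fgA)
    (u : mor fgA p q) :
    mor (procat (algfgCat K)) (frakA_ob p.1 p.2) (frakA_ob q.1 q.2) :=
  projT1 (cid (@frakA_rel_exists p.1 q.1 p.2 q.2 u.1 u.2)).

Lemma frakA_mapP (p q : fgA) (u : mor fgA p q) :
  @frakA_rel p.1 q.1 p.2 q.2 u.1 u.2 (frakA_map u).
Proof. exact: projT2 (cid _). Qed.

Lemma frakA_map_id (p : fgA) : frakA_map (idm p) = idm _.
Proof. exact: frakA_rel_uniq (frakA_mapP (idm p)) (frakA_rel_id _ _). Qed.

Lemma frakA_map_comp (p q r : fgA) (v : mor fgA q r) (u : mor fgA p q) :
  frakA_map (v \oc u) = frakA_map v \oc frakA_map u.
Proof.
apply: frakA_rel_uniq (frakA_mapP _) _.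
exact: frakA_rel_comp (frakA_mapP u) (frakA_mapP v).
Qed.

Definition frakA : frakA_type K :=
  @Functor fgA (procat (algfgCat K))
    (fun p => frakA_ob p.1 p.2) frakA_map frakA_map_id frakA_map_comp.

Lemma frakA_exists : @is_frakA K frakA (fun B C => frakA_h B C).
Proof.
split; last exact: frakA_h_universal.
move=> B B' C C' g f; exact: (frakA_mapP (p := (B, C)) (q := (B', C')) (g, f)).
Qed.

End Existence.

(** * Points *)

Section Points.
Variable K : fieldType.
Local Notation A := (procat (algCat K)).
Local Notation const := (fmap (constpro (algCat K))).
Local Notation Ko := (GRing.regular K : ualgType K).

Lemma runitor_linear (C : ualgType K) : linear (fun c : C => tpure c (aone : Ko)).
Proof. by have [+ _] := tpure_bilinear C Ko; apply. Qed.

Lemma runitor_mul (C : ualgType K) :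
  {morph (fun c : C => tpure c (aone : Ko)) : x y / x ** y}.
Proof. by move=> x y; rewrite tpureM amul1x. Qed.

Definition runitor (C : ualgType K) : alg_hom C (tensor C Ko) :=
  AlgHom (@runitor_linear C) erefl (@runitor_mul C).

Lemma runitor_bijective C : bijective (runitor C).
Proof.
have bil : is_bilinear (fun (c : C) (a : Ko) => (a : K) *: c).
  split=> [a b c c'|c b a a'] /=; last by rewrite scalerDl scalerA.
  by rewrite scalerDr !scalerA mulrC.
exists (tlift (fun c (a : Ko) => (a : K) *: c)) => [c|x].
  by rewrite /= tlift_pure // scale1r.
apply: (@tensor_ext _ _ _ _ (fun x => runitor C (tlift _ x)) id) => {x}.
- by move=> a x y; rewrite tlift_linear // alg_lin.
- by [].
move=> c a; rewrite tlift_pure //=.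
have [l r] := tpure_bilinear C Ko.
have lZ (W W' : lmodType K) (f : W -> W') :
    linear f -> forall b w, f (b *: w) = b *: f w.
  by move=> lf b w; have := scalable_linear lf; apply.
by rewrite (lZ _ _ _ (l _)) -(lZ _ _ _ (r _)); congr tpure; exact: mulr1.
Qed.

Program Definition prorunitor (C : algCat K) :
    mor A (proA_of C) (protensor K (proA_of C, proA_of Ko)) :=
  @ProHom (algCat K) (proA_of C) (protensor K (proA_of C, proA_of Ko))
    (fun j => @germ (algCat K) (proA_of C) (tensor (C : ualgType K) Ko) tt
      (runitor C)) _.
Next Obligation.
by rewrite cpost_germ; congr germ; rewrite tmap_id; apply: alg_hom_ext.
Qed.

Lemma prorunitor_germ (B : algfgCat K) (C : algCat K) (s : alg_hom (sval B) C) j :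
  (prorunitor C \oc const s : mor A (proA_of_fg B) _) j =
  @germ (algCat K) (proA_of_fg B) (tensor (C : ualgType K) Ko) tt
    (alg_comp (runitor C) s).
Proof.
rewrite [LHS](@procomp_funE (algCat K) (proA_of_fg B) (proA_of C)
  (protensor K (proA_of C, proA_of Ko)) _ _ j tt (runitor C)) //.
by rewrite cpost_germ.
Qed.

Lemma prorunitor_natural (C C' : algCat K) (u : alg_hom C C') :
  protensor_map (const u) (idm (proA_of Ko)) \oc prorunitor C =
  prorunitor C' \oc const u.
Proof.
apply: prohom_ext => -[[] []].
rewrite [LHS](@procomp_funE (algCat K) (proA_of C)
  (protensor K (proA_of C, proA_of Ko))
  (protensor K (proA_of C', proA_of Ko)) _ _ (tt, tt) (tt, tt)
  (tmap u (alg_id Ko))).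
  rewrite [RHS](@procomp_funE (algCat K) (proA_of C) (proA_of C')
    (protensor K (proA_of C', proA_of Ko)) _ _ (tt, tt) tt (runitor C')) //.
  rewrite !cpost_germ; congr germ; apply: alg_hom_ext => c.
  exact: tmap_pure.
exact: (@protensor_map_germ K (proA_of C) (proA_of C') (proA_of Ko)
  (proA_of Ko) (const u) (idm (proA_of Ko)) (tt, tt) tt tt u (alg_id Ko)
  erefl erefl).
Qed.

(** A pro-morphism between constant pro-objects is a morphism. *)
Lemma prorunitor_bijective (B : algfgCat K) (C : algCat K) :
  bijective (fun s : alg_hom (sval B) C =>
    prorunitor C \oc const s : mor A (proA_of_fg B) _).
Proof.
have [rinv rK Kr] := runitor_bijective C.
have sP (e : mor A (proA_of_fg B) (protensor K (proA_of C, proA_of Ko))) :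
    exists s : alg_hom (sval B) C, prorunitor C \oc const s = e.
  have [u uE] := const_germP (e (tt, tt)).
  have [|s sE] := alg_hom_lift (e := u) (can_inj rK).
    by move=> _ [b _ <-]; exists (rinv (u b)) => //; apply: Kr.
  exists s; apply: prohom_ext => -[[] []].
  by rewrite prorunitor_germ uE sE.
exists (fun e => projT1 (cid (sP e))) => [s|e]; last exact: projT2 (cid (sP e)).
case: cid => s' s'E /=; apply: alg_hom_ext => b; apply: (can_inj rK).
have := prorunitor_germ s' (tt, tt); rewrite s'E prorunitor_germ.
by move=> /const_germ_inj /(congr1 (fun f : alg_hom _ _ => f b)).
Qed.


Variables (FA : frakA_type K) (h : frakh_type FA).
Hypothesis FAh : is_frakA h.

Lemma point_of_exists (C : algCat K) (B : algfgCat K) (s : alg_hom (sval B) C) :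
  exists p : mor A (proAfg_incl K (FA (B, C))) (proA_of Ko),
    protensor_map (idm (proA_of C)) p \oc h B C = prorunitor C \oc const s.
Proof.
have [p [pE _]] := FAh.2 B C (proA_of Ko) (prorunitor C \oc const s).
by exists p.
Qed.

Lemma point_uniq (C : algCat K) (B : algfgCat K)
    (p q : mor A (proAfg_incl K (FA (B, C))) (proA_of Ko)) :
  protensor_map (idm (proA_of C)) p \oc h B C =
  protensor_map (idm (proA_of C)) q \oc h B C -> p = q.
Proof.
move=> pq; have [r [_ rU]] := FAh.2 B C (proA_of Ko)
  (protensor_map (idm (proA_of C)) p \oc h B C).
exact: etrans (esym (rU p erefl)) (rU q pq).
Qed.

Definition point_of (C : schCat K) (B : schfdCat K)
    (s : mor (schCat K) C (Sfd_incl K B)) :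
    points (IndSfd_incl K (frakM FA (C, B))) :=
  projT1 (cid (point_of_exists (C := C) (B := B) s)).

Lemma point_ofE (C : algCat K) (B : algfgCat K) (s : alg_hom (sval B) C) :
  protensor_map (idm (proA_of C)) (point_of (C := C) (B := B) s) \oc h B C =
  prorunitor C \oc const s.
Proof. exact: projT2 (cid (point_of_exists s)). Qed.

Lemma point_of_bijective C B : bijective (@point_of C B).
Proof.
have [tau phiK tauK] := @prorunitor_bijective B C.
exists (fun p => tau (protensor_map (idm (proA_of C)) p \oc h B C)) => [s|p].
  by rewrite point_ofE phiK.
by apply: point_uniq; rewrite point_ofE tauK.
Qed.

(** Composing with frak h, naturality of frak h moves v and u next to the point of
    s, where they meet the unitor. *)
Lemma point_of_natural (C C' : algCat K) (B B' : algfgCat K) (u : alg_hom C C')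
    (v : mor (algfgCat K) B' B) (s : alg_hom (sval B) C) :
  point_of (C := C') (B := B') (alg_comp u (alg_comp s v)) =
  (point_of (C := C) (B := B) s :
     mor A (proAfg_incl K (FA (B, C))) (proA_of Ko))
    \oc fmap (proAfg_incl K) (@fmap _ _ FA (B', C') (B, C) (v, u)).
Proof.
apply: point_uniq; rewrite point_ofE protensor_map_idl -Defs.compA.
rewrite (FAh.1 B' B C' C v u) !Defs.compA protensor_map_swap.
rewrite -(Defs.compA _ _ (h B C)) point_ofE Defs.compA prorunitor_natural.
rewrite -!Defs.compA; congr (_ \oc _).
by rewrite -!fmap_comp.
Qed.

End Points.

Theorem corollary2p7 (K : fieldType) :
  (exists (FA : frakA_type K) (h : frakh_type FA), is_frakA h) /\
  forall (FA : frakA_type K) (h : frakh_type FA), is_frakA h ->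
  exists theta : forall (S1 : schCat K) (S2 : schfdCat K),
      mor (schCat K) S1 (Sfd_incl K S2) ->
      points (IndSfd_incl K (frakM FA (S1, S2))),
    (forall (S1 : schCat K) (S2 : schfdCat K), bijective (theta S1 S2)) /\
    (forall (S1 S1' : schCat K) (S2 S2' : schfdCat K)
        (u : mor (schCat K) S1' S1) (v : mor (schfdCat K) S2 S2')
        (s : mor (schCat K) S1 (Sfd_incl K S2)),
      theta S1' S2' (fmap (Sfd_incl K) v \oc s \oc u) =
      points_map
        (fmap (IndSfd_incl K)
           (@fmap _ _ (frakM FA) (S1, S2) (S1', S2') (u, v)))
        (theta S1 S2 s)).
Proof.
split; first by exists (frakA K), (fun B C => frakA_h B C); apply: frakA_exists.
move=> FA h FAh; exists (point_of FAh); split; first exact: point_of_bijective.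
move=> C C' B B' u v s; exact: point_of_natural.
Qed.
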